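(* Let $X$ be a Banach space. If there exists a coarse embedding of $X$ into $T^*$ (resp. $S$), then there exists a map $f$ from $X$ into $T^*$ (resp. $S$) which is simultaneously a homeomorphism onto its image and a coarse embedding, and whose inverse $f^{-1}:f(X)\to X$ is uniformly continuous.
   Context: For a map $f:(M,d)\to(N,\partial)$ between metric spaces and $t\ge 0$, let $\omega_f(t)=\sup\{\partial(f(x),f(y)) : d(x,y)\le t\}$ and $\rho_f(t)=\inf\{\partial(f(x),f(y)) : d(x,y)\ge t\}$ (with $\inf\emptyset=\infty$). $f$ is coarse if $\omega_f(t)<\infty$ for all $t\ge 0$; expanding if $\lim_{t\to\infty}\rho_f(t)=\infty$; a coarse embedding (not assumed continuous) if it is both coarse and expanding. For finite subsets $E,F\subset\mathbb{N}$ write $E<F$ if $\max E<\min F$, and for $x\in c_{00}$ let $Ex$ be the restriction of $x$ to $E$ (zero off $E$). $T$ denotes the Tsirelson space introduced by Figiel and Johnson: the completion of $c_{00}$ under the unique norm satisfying $\|x\|=\max\{\|x\|_\infty,\ \tfrac12\sup\sum_{j=1}^k\|E_jx\|\}$, the supremum over all $k\in\mathbb{N}$ and finite nonempty sets $E_1<\dots<E_k$ with $k\le\min E_1$; $T^*$ is its dual. $S$ denotes the Schlumprecht space: the completion of $c_{00}$ under the unique norm satisfying $\|x\|=\max\{\|x\|_\infty,\ \sup_{k\ge2}\frac{1}{\log_2(k+1)}\sup\sum_{j=1}^k\|E_jx\|\}$, the inner supremum over all finite nonempty sets $E_1<\dots<E_k$. *)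

(* Defs.v *)
From HB Require Import structures.
From mathcomp Require Import all_boot all_order all_algebra finmap.
From mathcomp Require Import all_classical all_reals all_analysis.

Set Implicit Arguments.
Unset Strict Implicit.
Unset Printing Implicit Defensive.

Import Order.TTheory GRing.Theory Num.Theory.
Import numFieldNormedType.Exports.

Local Open Scope classical_set_scope.
Local Open Scope ring_scope.

Section Coarse.
Context {R : realType} {X Y : normedModType R}.
Implicit Type f : X -> Y.

Definition omega f (t : R) : \bar R :=
  ereal_sup [set `|f p.1 - f p.2|%:E | p in [set p : X * X | `|p.1 - p.2| <= t]].

(* [ereal_inf set0 = +oo], as the convention inf {} = oo requires. *)
Definition rho f (t : R) : \bar R :=
  ereal_inf [set `|f p.1 - f p.2|%:E | p in [set p : X * X | `|p.1 - p.2| >= t]].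

Definition coarse f := forall t : R, 0 <= t -> (omega f t < +oo)%E.

Definition expanding f := rho f t @[t --> +oo] --> +oo%E.

Definition coarse_embedding f := coarse f /\ expanding f.

End Coarse.

(* Here [g] plays the role of the inverse f^-1 : f(X) -> X; its values off
   [range f] are irrelevant. *)
Definition homeomorphism_onto_image (X Y : topologicalType)
    (f : X -> Y) (g : Y -> X) :=
  [/\ cancel f g, continuous f & {within range f, continuous g}].

Section C00.
Context {R : realType}.

Definition finsupp_pred : pred (nat -> R) :=
  fun x => `[< finite_set [set i | x i != 0] >].

Lemma finsupp_submod : submod_closed finsupp_pred.
Proof.
split=> [|a x y /asboolP fx /asboolP fy]; apply/asboolP.
  rewrite (_ : [set _ | _] = set0) //; apply/seteqP; split=> i //=.
  by rewrite eqxx.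
have fxy : finite_set ([set i | x i != 0] `|` [set i | y i != 0]).
  by rewrite finite_setU.
apply: sub_finite_set fxy => i /=.
have [xi0|xi0 _] := eqVneq (x i) 0; last by left.
move=> h; right; move: h; rewrite !fctE xi0.
by rewrite [_ *: _]scaler0 add0r.
Qed.

HB.instance Definition _ := GRing.isSubmodClosed.Build R (nat -> R)
  finsupp_pred finsupp_submod.

(* The index i : nat stands for the coordinate i.+1 of {1, 2, 3, ...}. *)
Definition c00 := {x : nat -> R | finsupp_pred x}.

HB.instance Definition _ := SubChoice.on c00.
HB.instance Definition _ := [SubChoice_isSubLmodule of c00 by <:].

End C00.
Arguments c00 : clear implicits.

Section BlockNorms.
Context {R : realType}.
Implicit Types (E F : {fset nat}) (x : c00 R) (N : c00 R -> R).

Lemma proj_finsupp E x :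
  finsupp_pred (fun i => if i \in E then val x i else 0).
Proof.
apply/asboolP; have /asboolP := valP x; apply: sub_finite_set => i /=.
by case: ifP => //; rewrite eqxx.
Qed.

Definition proj E x : c00 R := Sub _ (proj_finsupp E x).

(* max E < min F, for nonempty E and F *)
Definition fset_lt E F := all (fun i => all (fun j => (i < j)%N) F) E.

Definition successive (Es : seq {fset nat}) :=
  all (fun E => E != fset0) Es && sorted fset_lt Es.

(* k <= min E_1; the successor is the shift from indices to coordinates. *)
Definition admissible (Es : seq {fset nat}) :=
  [&& (0 < size Es)%N, successive Es &
    all (fun i => (size Es <= i.+1)%N) (head fset0 Es)].

Definition is_norm (V : lmodType R) (N : V -> R) :=
  [/\ forall u, N u = 0 -> u = 0,
      forall u v, N (u + v) <= N u + N v &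
      forall (a : R) u, N (a *: u) = `|a| * N u].

Definition sup_norm x : \bar R := ereal_sup (range (fun i => `|val x i|%:E)).

Definition block_sum N x (Es : seq {fset nat}) : \bar R :=
  (\sum_(E <- Es) N (proj E x))%:E.

(* The equations live in \bar R so that no supremum takes a default value. *)
Definition tsirelson_norm N :=
  is_norm N /\ forall x, (N x)%:E =
    maxe (sup_norm x)
      (2^-1%:E * ereal_sup [set block_sum N x Es | Es in [set Es | admissible Es]])%E.

Definition log2 (r : R) : R := ln r / ln 2.

Definition schlumprecht_norm N :=
  is_norm N /\ forall x, (N x)%:E =
    maxe (sup_norm x)
      (ereal_sup [set ((log2 k.+1%:R)^-1%:E * ereal_sup
          [set block_sum N x Es | Es in [set Es | successive Es /\ size Es = k]])%E
        | k in [set k : nat | (2 <= k)%N]]).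

End BlockNorms.

Section Spaces.
Context {R : realType}.
Implicit Type B : completeNormedModType R.

Definition completion_of (V : lmodType R) (N : V -> R) B :=
  exists iota : {linear V -> B},
    (forall u, `|iota u| = N u) /\ dense (range iota).

Definition is_tsirelson_space B :=
  exists2 N : c00 R -> R, tsirelson_norm N & completion_of N B.

Definition is_schlumprecht_space B :=
  exists2 N : c00 R -> R, schlumprecht_norm N & completion_of N B.

End Spaces.

Section Dual.
Context {R : realType} {V : normedModType R}.

Definition dual_pred : pred (V -> R^o) :=
  fun f => `[< linear f /\ continuous f >].

Lemma dual_submod : submod_closed dual_pred.
Proof.
split=> [|a f g /asboolP[lf cf] /asboolP[lg cg]]; apply/asboolP; split.
- by move=> b u v; rewrite [RHS]addr0 [RHS]scaler0.
- by move=> u; exact: cvg_cst.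
- move=> b u v; rewrite !fctE lf lg !scalerDr !scalerA mulrC.
  by rewrite addrACA.
- move=> u; apply: (@cvgD _ _ _ _ _ (fun x => a *: f x) g) => //.
    exact: cvgZr (cf u).
  exact: cg.
Qed.

HB.instance Definition _ := GRing.isSubmodClosed.Build R (V -> R^o)
  dual_pred dual_submod.

Definition dual := {f : V -> R^o | dual_pred f}.

HB.instance Definition _ := SubChoice.on dual.
HB.instance Definition _ := [SubChoice_isSubLmodule of dual by <:].

Implicit Types f g : dual.

Definition dual_norm f : R := sup [set `|val f u| | u in [set u | `|u| <= 1]].

Lemma dual_linear f : linear (val f).
Proof. by have /asboolP[] := valP f. Qed.

Lemma dual_has_sup f : has_sup [set `|val f u| | u in [set u | `|u| <= 1]].
Proof.
split; first by exists `|val f 0|, 0 => //=; rewrite normr0.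
have /asboolP[lf cf] := valP f.
pose F : {linear V -> R^o} := HB.pack (val f) (GRing.isLinear.Build _ _ _ _ _ lf).
have /bounded_funP/(_ 1)[M FM] : bounded_near F (nbhs (0 : V)).
  exact/linear_bounded_continuous.
by exists M => _ [u u1 <-]; exact: FM.
Qed.

Lemma dual_norm_ub f u : `|u| <= 1 -> `|val f u| <= dual_norm f.
Proof. by move=> u1; apply: sup_upper_bound (dual_has_sup f) _ _; exists u. Qed.

Lemma dual_norm_ge0 f : 0 <= dual_norm f.
Proof.
by apply: le_trans (@dual_norm_ub f 0 _); rewrite ?normr0.
Qed.

Lemma dual_normD f g : dual_norm (f + g) <= dual_norm f + dual_norm g.
Proof.
apply: ge_sup => [|_ [u u1 <-]]; first by case: (dual_has_sup (f + g)).
apply: le_trans (ler_normD _ _) _.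
by apply: lerD; exact: dual_norm_ub.
Qed.

Lemma dual_normZ_le (a : R) f : dual_norm (a *: f) <= `|a| * dual_norm f.
Proof.
apply: ge_sup => [|_ [u u1 <-]]; first by case: (dual_has_sup (a *: f)).
rewrite [X in X <= _](_ : _ = `|a| * `|val f u|); last by rewrite -normrM.
by apply: ler_wpM2l => //; exact: dual_norm_ub.
Qed.

Lemma dual_normZ (a : R) f : dual_norm (a *: f) = `|a| * dual_norm f.
Proof.
apply/eqP; rewrite eq_le dual_normZ_le /=.
have [->|a0] := eqVneq a 0; first by rewrite normr0 mul0r dual_norm_ge0.
have := dual_normZ_le a^-1 (a *: f).
rewrite scalerA mulVf // scale1r => h.
by apply: le_trans (ler_wpM2l (normr_ge0 a) h) _; rewrite mulrA -normrM mulfV // normr1 mul1r.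
Qed.

Lemma dual_norm0_eq0 f : dual_norm f = 0 -> f = 0.
Proof.
move=> f0; apply: val_inj; apply/funext => u.
have fu v : `|v| <= 1 -> val f v = 0.
  by move=> /(dual_norm_ub f); rewrite f0 normr_le0 => /eqP.
pose F : {linear V -> R^o} :=
  HB.pack (val f) (GRing.isLinear.Build _ _ _ _ _ (dual_linear f)).
have [->|u0] := eqVneq u 0; first by apply: fu; rewrite normr0.
have nu : `|u| != 0 by rewrite normr_eq0.
have : val f (`|u|^-1 *: u) = 0.
  by apply: fu; rewrite normrZ normfV normr_id mulVf.
rewrite -[val f]/(F : V -> R^o) linearZ /= => /eqP.
by rewrite scaler_eq0 invr_eq0 (negbTE nu) => /eqP.
Qed.

HB.instance Definition _ := Lmodule_isNormed.Build R dual
  dual_normD dual_normZ dual_norm0_eq0.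

End Dual.
Arguments dual {R} V.

(* Main.v *)
From HB Require Import structures.
Require Import Defs.
From mathcomp Require Import all_boot all_order all_algebra finmap.
From mathcomp Require Import all_classical all_reals all_analysis.
From mathcomp Require Import zify ring lra.

Set Implicit Arguments.
Unset Strict Implicit.
Unset Printing Implicit Defensive.

Import Order.TTheory GRing.Theory Num.Theory.
Import numFieldNormedType.Exports.

Local Open Scope classical_set_scope.
Local Open Scope ring_scope.

(** Let Y be the target space, T^* or S, and f : X -> Y a coarse embedding.

Besides completeness, one linear property of Y matters: it contains infinitely many copies of
itself in a split way, that is, there are bounded operators J_m, P_m on Y with
P_m J_n = 0 for m <> n and P_m J_m = 1 ([contains_copies]).

Given this, f is first replaced by a continuous map g at bounded distance from
f ([continuous_approximation]); g is an average of nearby values of f, weighted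
by a partition of unity on X in the style of Stone.  A coarse map on a normed
space satisfies |g x - g y| <= C (|x - y| + 1), so if eps_m > 0 decreases fast
enough the series

  F x = sum_m eps_m J_m (g ((m + 1) x) - g 0)

converges uniformly on bounded sets to a continuous coarse map.  Applying P_m
recovers g ((m + 1) x) from F x in a Lipschitz way.  The component m = 0 makes F
expanding.  Since g separates points at some distance t, the component m
separates points at distance t / (m + 1); letting m grow, F is injective and its
inverse is uniformly continuous ([coarse_to_homeomorphic]).

It remains to find the copies.  Let s_m i + 1 = 2 ^ m (2 i + 1); these maps are
increasing with disjoint ranges, and on finitely supported sequences J_m and P_m
are x |-> sum_i x_i e_(s_m i) and x |-> x o s_m.  They are norm decreasing for
the norm of S, whose definition is invariant under spreading.  For the norm of T
only P_m is obviously so: spreading to the right helps admissibility.  That J_m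
is bounded is [tsirelson_spread].  Its proof shows that the norm of a spread
vector is at most the largest sum of the norms of r successive pieces of the
vector: an admissible family of k blocks of the spread vector yields at most r k
successive pieces of the vector, starting at some coordinate p >= k / c (where
s_m i + 1 <= c (i + 1)), and such pieces fall into r admissible families, of p,
2 p, 4 p ... members, because p successive nonempty sets reach p coordinates
further.  The operators extend to the completions, and transposing them exchanges
their roles and gives the copies in T^* ([dual_copies]). *)

(** * Families of successive finite sets *)

Lemma fset_ltP (E F : {fset nat}) :
  reflect (forall i j, i \in E -> j \in F -> (i < j)%N) (fset_lt E F).
Proof.
apply: (iffP allP) => [h i j iE jF|h i iE].
  by have /allP := h i iE; exact.
by apply/allP => j jF; exact: h.
Qed.

Lemma fset_ltS (E E' F F' : {fset nat}) :
  {subset E' <= E} -> {subset F' <= F} -> fset_lt E F -> fset_lt E' F'.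
Proof.
by move=> sE sF /fset_ltP h; apply/fset_ltP => i j /sE iE /sF jF; exact: h.
Qed.

Lemma successive_pairwise (Es : seq {fset nat}) :
  successive Es -> pairwise fset_lt Es.
Proof.
move=> /andP[Es0]; rewrite (sorted_pairwise_in (P := fun E => E != fset0)) //.
move=> F E G F0 _ _ /fset_ltP EF /fset_ltP FG; apply/fset_ltP => i j iE jG.
have /fset0Pn[k kF] := F0.
exact: ltn_trans (EF _ _ iE kF) (FG _ _ kF jG).
Qed.

Lemma pairwise_successive (Es : seq {fset nat}) :
  pairwise fset_lt Es -> successive [seq E <- Es | E != fset0].
Proof.
move=> pEs; rewrite /successive filter_all /=.
by apply: pairwise_sorted; exact: pairwise_filter.
Qed.

Lemma pairwise_fset_ltS (h : {fset nat} -> {fset nat}) (Es : seq {fset nat}) :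
  (forall E F, fset_lt E F -> fset_lt (h E) (h F)) ->
  pairwise fset_lt Es -> pairwise fset_lt (map h Es).
Proof. by move=> hh; rewrite pairwise_map; apply: sub_pairwise => E F; exact: hh. Qed.

Local Notation proj := Defs.proj.

(** * Norms given by block sums *)

Section BlockNorm.
Context {R : realType}.
Implicit Types (E F : {fset nat}) (x : c00 R) (N : c00 R -> R).

Lemma c00_eq (x y : c00 R) : (forall i, val x i = val y i) -> x = y.
Proof. by move=> xy; apply: val_inj; apply/funext. Qed.

Lemma is_norm0 (V : lmodType R) (N : V -> R) : is_norm N -> N 0 = 0.
Proof. by move=> [_ _ NZ]; rewrite -(scale0r (0 : V)) NZ normr0 mul0r. Qed.

Lemma is_norm_ge0 (V : lmodType R) (N : V -> R) u : is_norm N -> 0 <= N u.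
Proof.
move=> Nn; have [_ ND NZ] := Nn.
have := ND u (-1 *: u); rewrite NZ scaleN1r subrr (is_norm0 Nn) normrN normr1.
by rewrite mul1r; lra.
Qed.

Lemma projE E x i : val (proj E x) i = if i \in E then val x i else 0.
Proof. by []. Qed.

Lemma proj0 x : proj fset0 x = 0.
Proof. by apply: c00_eq => i. Qed.

Lemma proj_proj E F x : proj E (proj F x) = proj (E `&` F)%fset x.
Proof.
apply: c00_eq => i /=; rewrite in_fsetI.
by case: (i \in E); case: (i \in F).
Qed.

(** The common shape of the two implicit norm equations, free of extended reals:
[adm] selects the families of blocks and [w k] is the weight of a family of [k]
blocks.  Families are allowed to have empty members in the instances below, which
makes them stable under intersections and inverse images. *)
Definition block_norm (adm : pred (seq {fset nat})) (w : nat -> R) N :=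
  [/\ is_norm N,
      forall x i, `|val x i| <= N x,
      forall x Es, adm Es -> w (size Es) * (\sum_(E <- Es) N (proj E x)) <= N x &
      forall x c, (forall i, `|val x i| <= c) ->
        (forall Es, adm Es -> w (size Es) * (\sum_(E <- Es) N (proj E x)) <= c) ->
        N x <= c].

(** Any [M] that satisfies the upper half of the norm equation along [u] dominates
[N o u].  Since the equation is implicit, this goes by induction on the size of
the support of [u x]: a family either cuts that support into smaller pieces, or
one of its blocks contains the whole support, and then the family contributes at
most [q * N (u x)] with [q < 1]. *)
Lemma block_norm_comparison (adm : pred (seq {fset nat})) (w : nat -> R) (q : R)
    N (M : c00 R -> R) (u : c00 R -> c00 R) (t : {fset nat} -> {fset nat}) :
  block_norm adm w N ->
  (forall Es, adm Es -> pairwise fset_lt Es) ->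
  (forall Es, adm Es -> 0 <= w (size Es) <= q) -> 0 <= q < 1 ->
  (forall E x, proj E (u x) = u (proj (t E) x)) ->
  (forall x, 0 <= M x) ->
  (forall x i, `|val (u x) i| <= M x) ->
  (forall x Es, adm Es ->
    w (size Es) * (\sum_(E <- Es) M (proj (t E) x)) <= M x) ->
  forall x, N (u x) <= M x.
Proof.
move=> [Nn N1 N2 N3] adm_lt w01 /andP[q0 q1] ut M0 M1 M2.
have N0 v := is_norm_ge0 v Nn.
suff H n : forall x (A : {fset nat}), (#|` A| <= n)%N ->
    (forall i, val (u x) i != 0 -> i \in A) -> N (u x) <= M x.
  move=> x; have /asboolP fx := valP (u x).
  apply: (H _ x (fset_set [set i | val (u x) i != 0])) => // i xi0.
  by rewrite in_fset_set //; exact/mem_set.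
elim: n => [|n IH] x A.
  rewrite leqn0 cardfs_eq0 => /eqP -> xA.
  suff -> : u x = 0 by rewrite (is_norm0 Nn).
  by apply: c00_eq => i; apply/eqP/negP => /negP /xA; rewrite in_fset0.
move=> cA xA.
suff : N (u x) <= Num.max (M x) (q * N (u x)).
  (* a number bounded by q times itself is at most 0 <= M x *)
  rewrite le_max => /orP[//|h]; have := N0 (u x); have := M0 x; nra.
apply: N3 => [i|Es aEs]; first by rewrite le_max M1.
have /andP[w0 wq] := w01 _ aEs.
have [/hasP[E EEs AE]|/hasPn nEs] := boolP (has (fun E => A `<=` E)%fset Es).
  have sumE : \sum_(F <- Es) N (proj F (u x)) = N (u x).
    have EuE : proj E (u x) = u x.
      apply: c00_eq => i /=; case: ifPn => // iE.
      apply/esym/eqP/negP => /negP /xA /(fsubsetP AE).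
      by rewrite (negbTE iE).
    have other F : fset_lt E F || fset_lt F E -> N (proj F (u x)) = 0.
      move=> h; suff -> : proj F (u x) = 0 by rewrite (is_norm0 Nn).
      apply: c00_eq => i /=; case: ifPn => // iF.
      apply/eqP/negP => /negP /xA /(fsubsetP AE) iE.
      by case/orP: h => /fset_ltP/(_ i i); rewrite ltnn => hi;
        have : false by exact: hi.
    have := adm_lt _ aEs; case/splitPr: EEs => s1 s2.
    rewrite pairwise_cat pairwise_cons => /and3P[/allrelP s12 _ /andP[/allP s2E _]].
    rewrite big_cat big_cons /= big1_seq ?big1_seq ?EuE ?add0r ?addr0 //.
      by move=> F /andP[_ Fs]; apply: other; rewrite s2E.
    move=> F /andP[_ Fs]; apply: other; apply/orP; right.
    by apply: s12 => //; rewrite mem_head.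
  rewrite sumE le_max; apply/orP; right.
  by apply: ler_wpM2r.
rewrite le_max; apply/orP; left; apply: le_trans (M2 x _ aEs).
apply: ler_wpM2l => //; rewrite big_seq [leRHS]big_seq.
apply: ler_sum => E EEs; rewrite ut; apply: (IH _ (E `&` A)%fset).
  rewrite -ltnS; apply: leq_trans cA; apply: fproper_ltn_card.
  rewrite fproperE fsubsetIr /=; apply: contra (nEs _ EEs) => h.
  by apply: fsubset_trans h _; exact: fsubsetIl.
move=> i; rewrite -ut /= in_fsetI; case: ifP => [iE|]; last by rewrite eqxx.
by move/xA.
Qed.

End BlockNorm.

(** * The Tsirelson and Schlumprecht norms as block norms *)

Section Instances.
Context {R : realType}.
Implicit Types (E F : {fset nat}) (x : c00 R) (N : c00 R -> R).

(** Admissibility for families with possibly empty members: [k] blocks supported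
on the coordinates from [k] on. *)
Definition late : pred (seq {fset nat}) := fun Es =>
  pairwise fset_lt Es && all (fun E => all (fun i => (size Es <= i.+1)%N) E) Es.

Definition several : pred (seq {fset nat}) := fun Es =>
  pairwise fset_lt Es && (1 < size Es)%N.

Lemma sum_proj_nonempty N x (Es : seq {fset nat}) : is_norm N ->
  \sum_(E <- Es) N (proj E x) = \sum_(E <- Es | E != fset0) N (proj E x).
Proof.
move=> Nn; rewrite [RHS]big_mkcond; apply: eq_bigr => E _.
by case: eqVneq => // ->; rewrite proj0 (is_norm0 Nn).
Qed.

Lemma admissible_late Es : admissible Es -> late Es.
Proof.
move=> /and3P[Es0 sEs]; rewrite /late (successive_pairwise sEs) /=.
case: Es Es0 sEs => //= E Es _ sEs hE; rewrite hE /=.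
have := successive_pairwise sEs; case/andP: sEs => /andP[E0 _] _.
move=> /andP[/allP EEs _]; have /fset0Pn[i iE] := E0.
apply/allP => F FEs; apply/allP => j jF.
have /fset_ltP/(_ i j iE jF) ij := EEs _ FEs.
by apply: leq_trans (allP hE i iE) _; exact: ltnW.
Qed.

Lemma late_admissible Es : late Es -> [seq E <- Es | E != fset0] != [::] ->
  admissible [seq E <- Es | E != fset0].
Proof.
move=> /andP[pEs lEs] Es0; apply/and3P; split.
- by rewrite lt0n size_eq0.
- exact: pairwise_successive.
- have sz : (size [seq E <- Es | E != fset0] <= size Es)%N.
    by rewrite size_filter count_size.
  have : head fset0 [seq E <- Es | E != fset0] \in [seq E <- Es | E != fset0].
    by case: [seq E <- Es | E != fset0] Es0 => //= F Fs _; rewrite mem_head.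
  rewrite mem_filter => /andP[_ /(allP lEs) hF].
  by apply/allP => i /(allP hF); exact: leq_trans.
Qed.

Lemma sup_norm_le x (c : R) : (forall i, `|val x i| <= c) -> (sup_norm x <= c%:E)%E.
Proof. by move=> h; apply: ge_ereal_sup => _ [i _ <-]; rewrite lee_fin. Qed.

Lemma le_sup_norm x i : (`|val x i|%:E <= sup_norm x)%E.
Proof. by apply: ereal_sup_ubound; exists i. Qed.

Lemma tsirelson_block_norm N : tsirelson_norm N -> block_norm late (fun=> 2^-1) N.
Proof.
move=> [Nn NE]; split => //.
- move=> x i; rewrite -lee_fin NE le_max; apply/orP; left; exact: le_sup_norm.
- move=> x Es lEs; rewrite sum_proj_nonempty // -big_filter.
  have [->|Es0] := eqVneq [seq E <- Es | E != fset0] [::].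
    by rewrite big_nil mulr0; exact: is_norm_ge0.
  rewrite -lee_fin NE le_max; apply/orP; right.
  rewrite EFinM; apply: lee_wpmul2l; first by rewrite lee_fin invr_ge0.
  apply: ereal_sup_ubound; exists [seq E <- Es | E != fset0] => //.
  exact: late_admissible.
- move=> x c x1 x2; rewrite -lee_fin NE ge_max sup_norm_le //=.
  rewrite lee_pdivrMl //; apply: ge_ereal_sup => _ [Es aEs <-].
  rewrite /block_sum -EFinM lee_fin.
  by have := x2 _ (admissible_late aEs); rewrite ler_pdivrMl.
Qed.

Lemma successive_several k Es :
  (2 <= k)%N -> successive Es -> size Es = k -> several Es.
Proof. by move=> k2 sEs sz; rewrite /several successive_pairwise // sz. Qed.

(** The weight depends on the number of blocks, so empty blocks cannot simply be
dropped; they are replaced by singletons beyond all other blocks. *)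
Lemma several_successive N x Es : is_norm N -> pairwise fset_lt Es ->
  exists Es', [/\ successive Es', size Es' = size Es &
    \sum_(E <- Es) N (proj E x) <= \sum_(E <- Es') N (proj E x)].
Proof.
move=> Nn pEs; pose Fs := [seq E <- Es | E != fset0].
pose m := (\max_(E <- Es) \max_(i <- E) i.+1)%N.
pose Gs := [seq [fset (m + j)%N]%fset | j <- iota 0 (size Es - size Fs)].
have sFs : (size Fs <= size Es)%N by rewrite size_filter count_size.
exists (Fs ++ Gs); split.
- have nFG : all (fun E => E != fset0) (Fs ++ Gs).
    rewrite all_cat filter_all all_map; apply/allP => j _ /=.
    by apply/fset0Pn; exists (m + j)%N; rewrite in_fset1.
  rewrite /successive nFG /=; apply: pairwise_sorted; rewrite pairwise_cat.
  apply/and3P; split.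
  + apply/allrelP => F G; rewrite mem_filter => /andP[_ FEs] /mapP[j _ ->].
    apply/fset_ltP => i k iF /fset1P ->.
    apply: leq_trans (leq_addr _ _).
    apply: leq_trans (leq_bigmax_seq _ FEs isT).
    exact: (@leq_bigmax_seq _ (enum_fset F) xpredT (fun i => i.+1) i).
  + exact: pairwise_filter.
  + rewrite pairwise_map; have := iota_ltn_sorted 0 (size Es - size Fs).
    rewrite sorted_pairwise; last exact: ltn_trans.
    apply: sub_pairwise => i j /= ij; apply/fset_ltP => a b /fset1P -> /fset1P ->.
    by rewrite ltn_add2l.
- by rewrite size_cat size_map size_iota subnKC.
- rewrite big_cat /= sum_proj_nonempty // big_filter lerDl.
  by apply: sumr_ge0 => E _; exact: is_norm_ge0.
Qed.

Lemma log2_gt0 k : (2 <= k)%N -> 0 < log2 (k.+1%:R : R).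
Proof. by move=> k2; rewrite /log2 divr_gt0 // ln_gt0 // ltr1n; lia. Qed.

Lemma schlumprecht_block_norm N :
  schlumprecht_norm N -> block_norm several (fun k => (log2 k.+1%:R)^-1) N.
Proof.
move=> [Nn NE]; split => //.
- move=> x i; rewrite -lee_fin NE le_max; apply/orP; left; exact: le_sup_norm.
- move=> x Es /andP[pEs s2].
  have [Es' [sEs' szEs' le]] := several_successive x Nn pEs.
  have l0 : 0 < (log2 (size Es).+1%:R : R)^-1 by rewrite invr_gt0 log2_gt0.
  apply: le_trans (ler_wpM2l (ltW l0) le) _.
  rewrite -lee_fin NE le_max; apply/orP; right.
  apply: (@le_trans _ _ ((log2 (size Es).+1%:R)^-1%:E * ereal_sup
          [set block_sum N x Es' | Es' in [set Es' | successive Es' /\ size Es' = size Es]])%E).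
    rewrite EFinM; apply: lee_wpmul2l; first by rewrite lee_fin ltW.
    by apply: ereal_sup_ubound; exists Es'.
  by apply: ereal_sup_ubound; exists (size Es).
- move=> x c x1 x2; rewrite -lee_fin NE ge_max sup_norm_le //=.
  apply: ge_ereal_sup => _ [k k2 <-]; have l0 := log2_gt0 k2.
  rewrite lee_pdivrMl //; apply: ge_ereal_sup => _ [Es [sEs szEs] <-].
  rewrite /block_sum -EFinM lee_fin.
  by have := x2 _ (successive_several k2 sEs szEs); rewrite szEs ler_pdivrMl.
Qed.

Lemma log2_inv_le Es : several Es ->
  0 <= (log2 (size Es).+1%:R : R)^-1 <= (log2 (3%:R : R))^-1.
Proof.
move=> /andP[_ s2]; have l0 := log2_gt0 s2; rewrite invr_ge0 ltW //=.
rewrite lef_pV2 ?posrE ?(log2_gt0 (k := 2)) //.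
rewrite /log2 ler_pM2r ?invr_gt0 ?ln_gt0 ?ltr1n //.
by rewrite ler_ln ?posrE ?ltr0n // ler_nat.
Qed.

Lemma log2_3_inv : 0 <= (log2 (3%:R : R))^-1 < 1.
Proof.
have l0 := log2_gt0 (k := 2) isT; rewrite invr_ge0 ltW //=.
rewrite invf_lt1 // /log2 ltr_pdivlMr ?mul1r ?ln_gt0 ?ltr1n //.
by rewrite ltr_ln ?posrE ?ltr0n // ltr_nat.
Qed.

Lemma several_pairwise Es : several Es -> pairwise fset_lt Es.
Proof. by case/andP. Qed.

Lemma late_pairwise Es : late Es -> pairwise fset_lt Es.
Proof. by case/andP. Qed.

(** * Spreading and compressing sequences *)

Section Spread.
Context (s : nat -> nat) (s_incr : {homo s : i j / (i < j)%N}).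

Lemma incr_inj : injective s.
Proof.
move=> i j sij; case: (ltngtP i j) => // /s_incr; by rewrite sij ltnn.
Qed.

Lemma incr_ge i : (i <= s i)%N.
Proof. by elim: i => // i; move/leq_ltn_trans; apply; exact: s_incr. Qed.

Lemma incr_lt i j : (s i < s j)%N = (i < j)%N.
Proof.
apply/idP/idP => [|/s_incr//]; case: (ltngtP i j) => // [/s_incr|->].
  by move=> /ltnW; rewrite leqNgt => /negbTE ->.
by rewrite ltnn.
Qed.

Lemma pull_finsupp x : finsupp_pred (fun i => val x (s i)).
Proof.
apply/asboolP; have /asboolP fx := valP x.
have := finite_preimage (f := s) (in2W incr_inj) fx.
by apply: sub_finite_set.
Qed.

Definition pull x : c00 R := Sub _ (pull_finsupp x).

Lemma spread_finsupp x :
  finsupp_pred (fun j => \sum_(i < j.+1 | s i == j) val x i : R).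
Proof.
apply/asboolP; have /asboolP fx := valP x.
apply: sub_finite_set (finite_image s fx) => j /= xj.
apply: contrapT => h; move/negP: xj; apply; apply/eqP.
apply: big1 => i /eqP sij; apply: contrapT => xi.
by apply: h; exists i => //; exact/eqP.
Qed.

(** When [s] is strictly increasing, the sum has at most one term, as [i <= s i = j]. *)
Definition spread x : c00 R := Sub _ (spread_finsupp x).

Lemma spreadE x i : val (spread x) (s i) = val x i.
Proof.
have i_lt : (i < (s i).+1)%N by rewrite ltnS incr_ge.
rewrite /= (bigD1 (Ordinal i_lt)) //= big1 ?addr0 // => j /andP[/eqP/incr_inj ji].
by move=> /eqP []; apply: val_inj.
Qed.

Lemma spread_out x j : (forall i, s i != j) -> val (spread x) j = 0.
Proof. by move=> h; rewrite /= big_pred0 // => i; apply/negbTE. Qed.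

Lemma pull_linear : linear pull.
Proof. by move=> a x y; apply: c00_eq. Qed.

Lemma spread_linear : linear spread.
Proof.
move=> a x y; apply: c00_eq => j /=.
rewrite -[RHS]/(a *: (\sum_(i < j.+1 | s i == j) val x i) + \sum_(i < j.+1 | s i == j) val y i).
by rewrite scaler_sumr -big_split.
Qed.

Definition preim_fset E : {fset nat} :=
  [fset i in iota 0 (\max_(j <- E) j).+1 | s i \in E]%fset.

Lemma in_preim_fset E i : (i \in preim_fset E) = (s i \in E).
Proof.
rewrite !inE /= mem_iota /= andbC; case sE: (s i \in E) => //=.
have : (i <= \max_(j <- E) j)%N.
  apply: leq_trans (incr_ge i) _.
  exact: (@leq_bigmax_seq _ (enum_fset E) xpredT id).
by case: (i) => // i' i'_lt; rewrite add1n ltnS i'_lt.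
Qed.

Lemma proj_pull E x : proj E (pull x) = pull (proj (s @` E)%fset x).
Proof. by apply: c00_eq => i /=; rewrite mem_imfset //; exact: incr_inj. Qed.

Lemma proj_spread E x : proj E (spread x) = spread (proj (preim_fset E) x).
Proof.
apply: c00_eq => j; have [[i sij]|h] := pselect (exists i, s i = j).
  by rewrite -sij projE !spreadE projE in_preim_fset.
have sj i : s i != j by apply/eqP => sij; apply: h; exists i.
by rewrite /= !big_pred0 ?if_same // => i; exact/negbTE.
Qed.

End Spread.
End Instances.

(** * Boundedness of spreading and compressing *)

Section Bounds.
Context {R : realType}.
Implicit Types (E F : {fset nat}) (x : c00 R) (N : c00 R -> R).

Lemma half_bounds (Es : seq {fset nat}) : late Es -> 0 <= (2^-1 : R) <= 2^-1.
Proof. by move=> _; rewrite lexx andbT invr_ge0. Qed.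

Lemma half01 : 0 <= (2^-1 : R) < 1.
Proof. lra. Qed.

Section Incr.
Context (s : nat -> nat) (s_incr : {homo s : i j / (i < j)%N}).

Lemma fset_lt_image E F : fset_lt E F -> fset_lt (s @` E)%fset (s @` F)%fset.
Proof.
move=> /fset_ltP EF; apply/fset_ltP => _ _ /imfsetP[i iE ->] /imfsetP[j jF ->].
by apply: s_incr; exact: EF.
Qed.

Lemma fset_lt_preim E F : fset_lt E F -> fset_lt (preim_fset s E) (preim_fset s F).
Proof.
move=> /fset_ltP EF; apply/fset_ltP => i j.
by rewrite !in_preim_fset // => iE jF; rewrite -(incr_lt s_incr); exact: EF.
Qed.

Lemma late_image Es : late Es -> late (map (fun E => s @` E)%fset Es).
Proof.
move=> /andP[pEs /allP lEs]; rewrite /late pairwise_fset_ltS //=; last first.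
  exact: fset_lt_image.
apply/allP => _ /mapP[E EEs ->]; apply/allP => _ /imfsetP[i iE ->].
rewrite size_map; apply: leq_trans (allP (lEs _ EEs) i iE) _.
by rewrite ltnS; exact: incr_ge.
Qed.

Lemma schlumprecht_pull N x : schlumprecht_norm N -> N (pull s_incr x) <= N x.
Proof.
move=> /schlumprecht_block_norm Nb; have [Nn N1 N2 _] := Nb.
apply: (block_norm_comparison Nb several_pairwise log2_inv_le log2_3_inv
  (proj_pull s_incr)) => {x} [x|x i|x Es].
- exact: is_norm_ge0.
- exact: (N1 x (s i)).
- move=> /andP[pEs s2]; rewrite -(size_map (fun E => s @` E)%fset).
  rewrite -(big_map _ xpredT (fun E => N (proj E x))).
  apply: N2; rewrite /several size_map s2 andbT.
  by apply: pairwise_fset_ltS pEs; exact: fset_lt_image.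
Qed.

Lemma schlumprecht_spread N x : schlumprecht_norm N -> N (spread s x) <= N x.
Proof.
move=> /schlumprecht_block_norm Nb; have [Nn N1 N2 _] := Nb.
apply: (block_norm_comparison Nb several_pairwise log2_inv_le log2_3_inv
  (proj_spread s_incr)) => {x} [x|x i|x Es].
- exact: is_norm_ge0.
- have [[j <-]|h] := pselect (exists j, s j = i); first by rewrite (spreadE s_incr); exact: N1.
  rewrite spread_out ?normr0 ?is_norm_ge0 // => j.
  by apply/eqP => sji; apply: h; exists j.
- move=> /andP[pEs s2]; rewrite -(size_map (preim_fset s)).
  rewrite -(big_map _ xpredT (fun E => N (proj E x))).
  apply: N2; rewrite /several size_map s2 andbT.
  by apply: pairwise_fset_ltS pEs; exact: fset_lt_preim.
Qed.

Lemma tsirelson_pull N x : tsirelson_norm N -> N (pull s_incr x) <= N x.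
Proof.
move=> /tsirelson_block_norm Nb; have [Nn N1 N2 _] := Nb.
apply: (block_norm_comparison Nb late_pairwise half_bounds half01
  (proj_pull s_incr)) => {x} [x|x i|x Es].
- exact: is_norm_ge0.
- exact: (N1 x (s i)).
- move=> lEs; rewrite -(big_map _ xpredT (fun E => N (proj E x))).
  by apply: N2; exact: late_image.
Qed.

End Incr.

Lemma tsirelson_proj N F x : tsirelson_norm N -> N (proj F x) <= N x.
Proof.
move=> /tsirelson_block_norm Nb; have [Nn N1 N2 _] := Nb.
have pp E (y : c00 R) : proj E (proj F y) = proj F (proj (E `&` F)%fset y).
  by rewrite !proj_proj fsetICA fsetIid.
apply: (block_norm_comparison (t := fun E => E `&` F)%fset
  Nb late_pairwise half_bounds half01 pp) => {x} [x|x i|x Es].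
- exact: is_norm_ge0.
- by rewrite projE; case: ifP; rewrite ?N1 // normr0 is_norm_ge0.
- move=> /andP[pEs /allP lEs].
  rewrite -(big_map (fun E => E `&` F)%fset xpredT (fun E => N (proj E x))).
  apply: N2; apply/andP; split.
    apply: pairwise_fset_ltS pEs => E G.
    by apply: fset_ltS; apply/fsubsetP; exact: fsubsetIl.
  apply/allP => _ /mapP[E EEs ->]; apply/allP => i.
  by rewrite size_map inE => /andP[iE _]; exact: (allP (lEs _ EEs)).
Qed.

(** Each nonempty set of a successive family starts at least one coordinate after
the previous one. *)
Lemma nth_late (Ps : seq {fset nat}) m j i : pairwise fset_lt Ps ->
  all (fun P => P != fset0) Ps -> (forall P i, P \in Ps -> i \in P -> (m <= i.+1)%N) ->
  i \in nth fset0 Ps j -> (m + j <= i.+1)%N.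
Proof.
elim: Ps m j => [|P Ps IH] m j; first by rewrite nth_nil.
rewrite pairwise_cons => /andP[/allP PPs pPs] /= /andP[/fset0Pn[p pP] nPs] h.
case: j => [|j] /= ij; first by rewrite addn0; apply: (h P) => //; exact: mem_head.
rewrite addnS -addSn; apply: IH ij => // Q k QPs kQ.
have /fset_ltP/(_ p k pP kQ) pk := PPs _ QPs.
have mp : (m <= p.+1)%N by apply: (h P) => //; exact: mem_head.
by rewrite ltnS; exact: leq_trans mp pk.
Qed.

(** The first [m] sets form an admissible family and are replaced by their union;
the others start beyond coordinate [2 m] by [nth_late], so that the next [2 m] can
be treated alike.  After [r] steps, [m + 2 m + ... + 2 ^ (r - 1) m] sets have
been used. *)
Lemma tsirelson_regroup N x r m (Ps : seq {fset nat}) : tsirelson_norm N ->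
  pairwise fset_lt Ps -> all (fun P => P != fset0) Ps ->
  (forall P i, P \in Ps -> i \in P -> (m <= i.+1)%N) ->
  (size Ps <= (2 ^ r - 1) * m)%N ->
  exists Gs, [/\ pairwise fset_lt Gs, (size Gs <= r)%N,
    forall G i, G \in Gs -> i \in G -> exists2 P, P \in Ps & i \in P &
    2^-1 * (\sum_(P <- Ps) N (proj P x)) <= \sum_(G <- Gs) N (proj G x)].
Proof.
move=> /tsirelson_block_norm [Nn _ N2 _].
elim: r m Ps => [|r IH] m Ps pPs nPs late_m sz.
  exists [::]; split => //; move: sz; rewrite expn0 subnn mul0n leqn0 size_eq0.
  by move=> /eqP ->; rewrite !big_nil mulr0.
have split_Ps := cat_take_drop m Ps.
have /and3P[/allrelP p12 p1 p2] : [&& allrel fset_lt (take m Ps) (drop m Ps),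
    pairwise fset_lt (take m Ps) & pairwise fset_lt (drop m Ps)].
  by rewrite -pairwise_cat split_Ps.
have /andP[n1 n2] : all (fun P => P != fset0) (take m Ps) &&
    all (fun P => P != fset0) (drop m Ps).
  by rewrite -all_cat split_Ps.
have [//|//|P i /(nthP fset0)[k _ <-]||Gs [pGs szGs Gs_sub leGs]] := IH (2 * m)%N (drop m Ps).
- rewrite nth_drop => ik; have := nth_late pPs nPs late_m ik.
  by apply: leq_trans; rewrite addnA mul2n -addnn leq_addr.
- rewrite size_drop; move: sz; rewrite expnS.
  have := expn_gt0 2 r; nia.
pose U := (\bigcup_(P <- take m Ps) P)%fset.
have PU P : P \in take m Ps -> (P `&` U = P)%fset.
  move=> PPs; apply/fsetIidPl; apply/fsubsetP => i iP.
  by apply/bigfcupP; exists P; rewrite ?PPs.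
exists (U :: Gs); split.
- rewrite pairwise_cons pGs andbT; apply/allP => G GGs; apply/fset_ltP => i j.
  move=> /bigfcupP[P]; rewrite andbT => P1 iP jG.
  have [Q Q2 jQ] := Gs_sub _ _ GGs jG.
  by have /fset_ltP := p12 _ _ P1 Q2; exact.
- by rewrite /= ltnS.
- move=> G i; rewrite inE => /predU1P[->|GGs iG].
    by move=> /bigfcupP[P]; rewrite andbT => P1 iP; exists P => //; exact: mem_take P1.
  by have [P P2 iP] := Gs_sub _ _ GGs iG; exists P => //; exact: mem_drop P2.
- rewrite -[in leLHS]split_Ps big_cat big_cons /= mulrDr; apply: lerD => //.
  have -> : \sum_(P <- take m Ps) N (proj P x) = \sum_(P <- take m Ps) N (proj P (proj U x)).
    by rewrite big_seq [RHS]big_seq; apply: eq_bigr => P P1; rewrite proj_proj PU.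
  apply: N2; rewrite /late p1 /=; apply/allP => P P1; apply/allP => i iP.
  apply: (@leq_trans m); first by rewrite size_take_min geq_minl.
  by apply: (late_m P) => //; exact: mem_take P1.
Qed.

Definition split_sums N r x : set R :=
  [set \sum_(G <- Gs) N (proj G x) | Gs in
    [set Gs : seq {fset nat} | pairwise fset_lt Gs /\ (size Gs <= r)%N]].

(** For [r > 0], an equivalent norm which sees [r] successive pieces of a vector at once; unlike
the Tsirelson norm itself, it controls spread vectors with constant one. *)
Definition split_norm N r x : R := sup (split_sums N r x).

Lemma split_sums_le N r x v : tsirelson_norm N -> split_sums N r x v -> v <= r%:R * N x.
Proof.
move=> NT [Gs [_ szGs] <-]; have Nn := NT.1.
apply: (@le_trans _ _ ((size Gs)%:R * N x)); last first.
  by apply: ler_wpM2r; rewrite ?is_norm_ge0 ?ler_nat.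
elim: Gs {szGs} => [|G Gs IH]; first by rewrite big_nil mul0r.
by rewrite big_cons /= -natr1 mulrDl mul1r addrC lerD // tsirelson_proj.
Qed.

Lemma split_sums_has_sup N r x : tsirelson_norm N -> has_sup (split_sums N r x).
Proof.
move=> NT; split; first by exists 0, [::] => //; rewrite big_nil.
by exists (r%:R * N x) => v; exact: split_sums_le.
Qed.

Lemma le_split_norm N r x Gs : tsirelson_norm N -> pairwise fset_lt Gs ->
  (size Gs <= r)%N -> \sum_(G <- Gs) N (proj G x) <= split_norm N r x.
Proof.
move=> NT pGs szGs.
by apply: (ub_le_sup (split_sums_has_sup r x NT).2); exists Gs.
Qed.

(** This makes [r = 2 c] groups enough for [r * c * m] sets. *)
Lemma sqr_le_pow2 c : (c * (2 * c) <= 2 ^ (2 * c) - 1)%N.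
Proof.
suff : (2 * c * c + 1 <= 4 ^ c)%N by rewrite -[4%N]/(2 ^ 2)%N -expnM; lia.
by elim: c => // c IH; rewrite expnS; nia.
Qed.

(** The half of the Tsirelson equation that [split_norm] has to satisfy along
[spread s].  Choosing [2 c] nearly optimal pieces for each of the [k] blocks
gives [2 c k] successive sets, which [tsirelson_regroup] gathers into [2 c]. *)
Lemma split_norm_blocks N s (s_incr : {homo s : i j / (i < j)%N}) c x Es :
  tsirelson_norm N -> (forall i, (s i).+1 <= c * i.+1)%N -> late Es ->
  2^-1 * (\sum_(E <- Es) split_norm N (2 * c) (proj (preim_fset s E) x)) <=
    split_norm N (2 * c) x.
Proof.
move=> NT s_lin /andP[pEs /allP lEs].
have sup_x y := split_sums_has_sup (2 * c) y NT.
have [Es0|k0] := posnP (size Es).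
  rewrite (size0nil Es0) big_nil mulr0.
  by have := @le_split_norm N (2 * c) x [::] NT isT isT; rewrite big_nil.
apply/ler_addgt0Pr => e e0; pose e' := e / (size Es)%:R.
have e'0 : 0 < e' by rewrite divr_gt0 // ltr0n.
have /choice[Gf GfP] : forall E, exists Gs, [/\ pairwise fset_lt Gs, (size Gs <= 2 * c)%N &
    split_norm N (2 * c) (proj (preim_fset s E) x) <=
      \sum_(G <- Gs) N (proj G (proj (preim_fset s E) x)) + e'].
  move=> E; have [_ [Gs [pGs szGs] <-] lt] := sup_adherent e'0 (sup_x (proj (preim_fset s E) x)).
  by exists Gs; split => //; rewrite -lerBlDr; exact: ltW.
pose cut E := [seq (G `&` preim_fset s E)%fset | G <- Gf E].
pose Ps0 := flatten (map cut Es); pose Ps := [seq P <- Ps0 | P != fset0].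
have cutE E P i : P \in cut E -> i \in P -> s i \in E.
  by move=> /mapP[G _ ->]; rewrite in_fsetI (in_preim_fset s_incr) => /andP[].
have pcut E : pairwise fset_lt (cut E).
  have [pG _ _] := GfP E; rewrite /cut; apply: pairwise_fset_ltS pG => G H.
  by apply: fset_ltS; apply/fsubsetP; exact: fsubsetIl.
have pPs0 : pairwise fset_lt Ps0.
  rewrite /Ps0; elim: Es pEs {lEs k0 e' e'0 GfP Ps Ps0} => //= E Es IH /andP[/allP EEs /IH{}IH].
  rewrite pairwise_cat pcut IH !andbT; apply/allrelP => P Q PE /flattenP[_ /mapP[F FEs ->] QF].
  apply/fset_ltP => i j iP jQ; rewrite -(incr_lt s_incr).
  by have /fset_ltP := EEs _ FEs; apply; [exact: cutE iP|exact: cutE jQ].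
have szPs0 : (size Ps0 <= 2 * c * size Es)%N.
  rewrite /Ps0; elim: (Es) => //= E Fs IH; rewrite size_cat mulnS leq_add //.
  by rewrite size_map; have [] := GfP E.
have c0 : (0 < c)%N by have := s_lin 0%N; lia.
(* m is k / c rounded up, where k is the number of blocks; the linear growth of s
   places all pieces at coordinates >= m *)
pose m := ((size Es).-1 %/ c).+1.
have [|P i||Gs [pGs szGs _ leGs]] :=
  @tsirelson_regroup N x (2 * c) m Ps NT (pairwise_filter _ pPs0).
- exact: filter_all.
- rewrite mem_filter => /andP[_ /flattenP[_ /mapP[E EEs ->] Pc]] iP.
  have sEs := allP (lEs _ EEs) _ (cutE _ _ _ Pc iP).
  rewrite /m ltn_divLR // mulnC; apply: leq_trans (s_lin i).
  by rewrite prednK.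
- have szPs : (size Ps <= size Ps0)%N by rewrite size_filter count_size.
  have mE : (size Es <= m * c)%N by rewrite /m -(prednK k0) ltn_ceil.
  apply: leq_trans szPs (leq_trans szPs0 _).
  apply: (@leq_trans (c * (2 * c) * m)); last by rewrite leq_mul2r sqr_le_pow2 orbT.
  have -> : (c * (2 * c) * m = 2 * c * (m * c))%N by ring.
  by rewrite leq_mul2l mE orbT.
have sumPs : \sum_(P <- Ps) N (proj P x) = \sum_(E <- Es) \sum_(P <- cut E) N (proj P x).
  by rewrite big_filter -sum_proj_nonempty ?big_flatten ?big_map //; exact: NT.1.
have step : 2^-1 * (\sum_(E <- Es) split_norm N (2 * c) (proj (preim_fset s E) x)) <=
    2^-1 * (\sum_(P <- Ps) N (proj P x) + \sum_(E <- Es) e').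
  rewrite sumPs -big_split /=; apply: ler_wpM2l; first by rewrite invr_ge0.
  apply: ler_sum => E _; have [_ _] := GfP E => /le_trans; apply.
  by rewrite /cut big_map lerD2r; apply: ler_sum => G _; rewrite proj_proj.
apply: le_trans step _; rewrite mulrDr; apply: lerD.
  by apply: le_trans leGs _; exact: le_split_norm.
have -> : \sum_(E <- Es) e' = e.
  rewrite big_const_seq count_predT iter_addr_0 -[_ *+ _]mulr_natr /e'.
  by rewrite divfK // pnatr_eq0 -lt0n.
by rewrite ler_pdivrMl //; lra.
Qed.

Lemma tsirelson_spread N s (s_incr : {homo s : i j / (i < j)%N}) c x :
  tsirelson_norm N -> (forall i, (s i).+1 <= c * i.+1)%N ->
  N (spread s x) <= (2 * c)%:R * N x.
Proof.
move=> NT s_lin.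
have c0 : (0 < 2 * c)%N by have := s_lin 0%N; lia.
have M0 y : 0 <= split_norm N (2 * c) y.
  by have := @le_split_norm N (2 * c) y [::] NT isT isT; rewrite big_nil.
apply: (@le_trans _ _ (split_norm N (2 * c) x)); last first.
  apply: ge_sup; first by have [] := split_sums_has_sup (2 * c) x NT.
  by move=> v; exact: split_sums_le.
have Nb := tsirelson_block_norm NT; have [Nn N1 _ _] := Nb.
apply: (block_norm_comparison Nb late_pairwise half_bounds half01
  (proj_spread s_incr) M0) => {x} [x i|x Es lEs]; last exact: split_norm_blocks.
have [[j <-]|h] := pselect (exists j, s j = i); last first.
  rewrite spread_out ?normr0 // => j.
  by apply/eqP => sji; apply: h; exists j.
rewrite (spreadE s_incr); apply: le_trans (le_split_norm x (Gs := [:: [fset j]%fset]) NT isT c0).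
by rewrite big_seq1; apply: le_trans (N1 _ j); rewrite projE in_fset1 eqxx.
Qed.

End Bounds.

(** * Bounded operators, geometric series and completions *)

Section Operators.
Context {R : realType}.

Definition bounded_operator (V W : normedModType R) (u : V -> W) :=
  linear u /\ exists2 K : R, 0 < K & forall x, `|u x| <= K * `|x|.

(** Completeness for series dominated by a geometric one.  The explicit remainder
reduces statements about limits to [le_geom]. *)
Definition geometrically_complete (Y : normedModType R) :=
  forall (u : nat -> Y) (C : R), (forall n, `|u n| <= C * 2^-1 ^+ n.+1) ->
    exists s, forall n, `|s - \sum_(i < n) u i| <= C * 2^-1 ^+ n.

Definition contains_copies (Y : normedModType R) :=
  exists J P : nat -> Y -> Y, [/\ forall m, bounded_operator (J m),
    forall m, bounded_operator (P m) &
    forall m n y, P m (J n y) = if m == n then y else 0].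

Lemma geom_lt (C e : R) : 0 < e -> exists n, C * 2^-1 ^+ n < e.
Proof.
move=> e0.
have [C0|C0] := leP C 0.
  by exists 0%N; rewrite expr0 mulr1; exact: le_lt_trans e0.
have h : (fun n => 2^-1 ^+ n : R) @ \oo --> (0 : R).
  by apply: cvg_expr; rewrite gtr0_norm ?invf_lt1 ?ltr1n // invr_gt0.
have /cvgr0_norm_lt/(_ _ (divr_gt0 e0 C0))[n _ /(_ n (leqnn n))] /= := h.
rewrite ger0_norm ?exprn_ge0 ?invr_ge0 //.
by rewrite ltr_pdivlMr // mulrC; exists n.
Qed.

Lemma le_geom (C x y : R) : (forall n, x <= y + C * 2^-1 ^+ n) -> x <= y.
Proof.
move=> h; apply/ler_addgt0Pr => e /(geom_lt C)[n Cn].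
by apply: le_trans (h n) _; rewrite lerD2l ltW.
Qed.

Lemma geom_sum_le (Y : normedModType R) (u : nat -> Y) (C : R) n k :
  (forall n, `|u n| <= C * 2^-1 ^+ n.+1) ->
  `|\sum_(i < n + k) u i - \sum_(i < n) u i| <= C * (2^-1 ^+ n - 2^-1 ^+ (n + k)).
Proof.
move=> uC; elim: k => [|k IH]; first by rewrite addn0 !subrr normr0 mulr0.
rewrite addnS big_ord_recr /= addrAC; apply: le_trans (ler_normD _ _) _.
by apply: le_trans (lerD IH (uC (n + k)%N)) _; rewrite exprS; lra.
Qed.

Lemma complete_geometrically_complete (Y : completeNormedModType R) :
  geometrically_complete Y.
Proof.
move=> u C uC.
have C0 : 0 <= C.
  have := le_trans (normr_ge0 _) (uC 0%N); rewrite expr1.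
  by rewrite pmulr_lge0 // invr_gt0.
have pow0 n : 0 <= (2^-1 : R) ^+ n by rewrite exprn_ge0 // invr_ge0.
have dist n m : (n <= m)%N -> `|\sum_(i < m) u i - \sum_(i < n) u i| <= C * 2^-1 ^+ n.
  move=> /subnKC <-; apply: le_trans (geom_sum_le _ _ uC) _.
  by apply: ler_wpM2l => //; rewrite lerBlDr lerDl.
pose S n := \sum_(i < n) u i.
have /cauchy_cvgP cS : cauchy (S @ \oo).
  apply: cauchy_exP => e e0; have [n Cn] := geom_lt C e0.
  exists (S n); exists n => // m /= nm; rewrite -ball_normE /= distrC.
  by apply: le_lt_trans Cn; exact: dist.
exists (lim (S @ \oo)) => n.
apply/ler_addgt0Pr => e e0.
move/cvgrPdist_lt : cS => /(_ _ e0)[m _ /(_ (maxn m n) (leq_maxl _ _)) hm].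
have := dist _ _ (leq_maxr m n) => hd.
have -> : lim (S @ \oo) - \sum_(i < n) u i =
  (lim (S @ \oo) - S (maxn m n)) + (S (maxn m n) - \sum_(i < n) u i).
  by rewrite addrA subrK.
apply: le_trans (ler_normD _ _) _; rewrite addrC; apply: lerD => //.
exact: ltW.
Qed.

Lemma dense_approx (V : normedModType R) (D : set V) x (e : R) :
  dense D -> 0 < e -> exists2 y, D y & `|x - y| < e.
Proof.
move=> dD e0; have [|y [xy Dy]] := dD (ball x e) _ (ball_open_nbhs x e0).1.
  by exists x; exact: ballxx.
by exists y => //; move: xy; rewrite -ball_normE.
Qed.

Lemma bounded_operatorB (V W : normedModType R) (u : V -> W) x y :
  bounded_operator u -> u (x - y) = u x - u y.
Proof. by move=> [lu _]; rewrite -[x - y]addrC -scaleN1r lu scaleN1r addrC. Qed.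

Lemma bounded_operator_eq (V W : normedModType R) (u v : V -> W) (D : set V) :
  bounded_operator u -> bounded_operator v -> dense D ->
  (forall x, D x -> u x = v x) -> forall x, u x = v x.
Proof.
move=> bu bv dD uv x; have [_ [K K0 uK]] := bu; have [_ [L L0 vL]] := bv.
apply/eqP; rewrite -subr_eq0 -normr_le0; apply/ler_addgt0Pr => e e0; rewrite add0r.
have [y Dy xy] := dense_approx x dD (divr_gt0 e0 (addr_gt0 K0 L0)).
have -> : u x - v x = u (x - y) - v (x - y).
  by rewrite (bounded_operatorB _ _ bu) (bounded_operatorB _ _ bv) (uv y Dy) opprB addrA subrK.
apply: le_trans (ler_normB _ _) _; apply: le_trans (lerD (uK _) (vL _)) _.
by rewrite -mulrDl mulrC -ler_pdivlMr ?addr_gt0 // ltW.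
Qed.

(** The extension is the closure of the graph of [u] inside [B * B].  It is a linear
subspace, the bound [K] passes to it and makes it single valued, and it is total
by completeness. *)
Lemma extend_operator (V : lmodType R) (N : V -> R) (B : normedModType R)
    (iota : {linear V -> B}) (u : V -> V) (K : R) :
  is_norm N -> (forall x, `|iota x| = N x) -> dense (range iota) ->
  geometrically_complete B -> linear u -> 0 < K -> (forall x, N (u x) <= K * N x) ->
  exists2 v : B -> B, bounded_operator v & forall x, v (iota x) = iota (u x).
Proof.
move=> Nn isom dB cB lu K0 uK.
pose G t s := forall e, 0 < e -> exists x, `|t - iota x| < e /\ `|s - iota (u x)| < e.
have uB x y : u (x - y) = u x - u y.
  by rewrite -[x - y]addrC -scaleN1r lu scaleN1r addrC.
have G_le t s : G t s -> `|s| <= K * `|t|.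
  move=> Gts; apply/ler_addgt0Pr => e e0.
  have e'0 : 0 < e / (K + 1) by rewrite divr_gt0 // addr_gt0.
  have [x [tx sx]] := Gts _ e'0.
  have le1 : `|s| <= `|s - iota (u x)| + K * `|iota x|.
    rewrite -{1}(subrK (iota (u x)) s); apply: le_trans (ler_normD _ _) _.
    by rewrite lerD2l !isom.
  have le2 : `|iota x| <= `|t| + e / (K + 1).
    rewrite -(subKr t (iota x)); apply: le_trans (ler_normB _ _) _.
    by rewrite lerD2l ltW.
  apply: le_trans le1 _.
  have eE : e = e / (K + 1) * (K + 1) by rewrite divfK // gt_eqF // addr_gt0.
  have := ler_wpM2l (ltW K0) le2; rewrite [X in _ -> _ <= _ + X]eE; nra.
have G_lin a t s t' s' : G t s -> G t' s' -> G (a *: t + t') (a *: s + s').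
  move=> Gts Gts' e e0.
  have e'0 : 0 < e / (`|a| + 1) by rewrite divr_gt0 // ltr_wpDl.
  have [x [tx sx]] := Gts _ e'0; have [x' [tx' sx']] := Gts' _ e'0.
  have bound (p p' q q' : B) : `|p - q| < e / (`|a| + 1) -> `|p' - q'| < e / (`|a| + 1) ->
      `|a *: p + p' - (a *: q + q')| < e.
    move=> pq pq'; rewrite opprD addrACA -scalerBr.
    apply: le_lt_trans (ler_normD _ _) _; rewrite normrZ.
    have eE : e = e / (`|a| + 1) * (`|a| + 1) by rewrite divfK // gt_eqF // ltr_wpDl.
    have := ler_wpM2l (normr_ge0 a) (ltW pq); rewrite [X in _ -> _ < X]eE; nra.
  by exists (a *: x + x'); rewrite lu !(linearP iota); split; exact: bound.
have G_fun t s s' : G t s -> G t s' -> s = s'.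
  move=> Gs Gs'; have := G_le _ _ (G_lin (-1) _ _ _ _ Gs' Gs).
  rewrite !scaleN1r addNr normr0 mulr0 normr_le0 addrC subr_eq0.
  by move/eqP.
have G_tot t : exists s, G t s.
  have p0 n : 0 < (2^-1 : R) ^+ n by rewrite exprn_gt0 // invr_gt0.
  have /choice[x xP] : forall n, exists x, `|t - iota x| < 2^-1 ^+ n.
    by move=> n; have [_ [x _ <-]] := dense_approx t dB (p0 n); exists x.
  have dx n : `|iota (u (x n.+1)) - iota (u (x n))| <= (3 * K) * 2^-1 ^+ n.+1.
    rewrite -linearB -uB isom; apply: le_trans (uK _) _.
    rewrite -isom linearB [3 * K]mulrC -mulrA; apply: ler_wpM2l; first exact: ltW.
    have -> : iota (x n.+1) - iota (x n) = (t - iota (x n)) - (t - iota (x n.+1)).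
      by rewrite opprB [RHS]addrC addrA subrK.
    apply: le_trans (ler_normB _ _) _; apply: le_trans (lerD (ltW (xP n)) (ltW (xP n.+1))) _.
    by rewrite exprS; lra.
  have [s sP] := cB _ _ dx.
  exists (s + iota (u (x 0%N))) => e e0.
  have [n1 n1e] := geom_lt (3 * K) e0; have [n2 n2e] := geom_lt 1 e0.
  have pmon n m : (n <= m)%N -> (2^-1 : R) ^+ m <= 2^-1 ^+ n.
    by apply: ler_wiXn2l; rewrite ?invr_ge0 ?invf_le1 ?ler1n.
  exists (x (maxn n1 n2)); split.
    apply: lt_trans (xP _) (le_lt_trans _ n2e); rewrite mul1r.
    by apply: pmon; rewrite leq_maxr.
  have := sP (maxn n1 n2).
  rewrite -(big_mkord xpredT (fun i => iota (u (x i.+1)) - iota (u (x i)))).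
  rewrite telescope_sumr // opprB addrA => /le_lt_trans; apply.
  apply: le_lt_trans n1e; apply: ler_wpM2l; last by apply: pmon; rewrite leq_maxl.
  by rewrite mulr_ge0 // ltW.
have /choice[v vP] := G_tot.
have viota x : v (iota x) = iota (u x).
  by apply: G_fun (vP _) _ => e e0; exists x; rewrite !subrr normr0.
exists v => //; split; last by exists K => // t; exact: G_le.
by move=> a s t; apply: G_fun (vP _) _; exact: G_lin.
Qed.

Lemma completion_copies (V : lmodType R) (N : V -> R) (B : completeNormedModType R)
    (J P : nat -> V -> V) : is_norm N -> completion_of N B ->
  (forall m, linear (J m)) -> (forall m, linear (P m)) ->
  (forall m, exists2 K : R, 0 < K & forall x, N (J m x) <= K * N x) ->
  (forall m, exists2 K : R, 0 < K & forall x, N (P m x) <= K * N x) ->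
  (forall m n x, P m (J n x) = if m == n then x else 0) ->
  contains_copies B.
Proof.
move=> Nn [iota [isom dB]] lJ lP bJ bP PJ.
have cB := complete_geometrically_complete (Y := B).
have ext (u : nat -> V -> V) : (forall m, linear (u m)) ->
    (forall m, exists2 K : R, 0 < K & forall x, N (u m x) <= K * N x) ->
    exists v : nat -> B -> B, forall m, bounded_operator (v m) /\
      forall x, v m (iota x) = iota (u m x).
  move=> lu bu.
  have : forall m, exists v : B -> B, bounded_operator v /\ forall x, v (iota x) = iota (u m x).
    move=> m; have [K K0 uK] := bu m.
    by have [v bv vi] := extend_operator Nn isom dB cB (lu m) K0 uK; exists v.
  by move=> /choice[v vP]; exists v.
have [J' J'P] := ext _ lJ bJ; have [P' P'P] := ext _ lP bP.
exists J', P'; split=> [m|m|m n]; [exact: (J'P m).1|exact: (P'P m).1|].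
have [[lJ' [K K0 JK]] [lP' [L L0 PL]]] := ((J'P n).1, (P'P m).1).
apply: (bounded_operator_eq _ _ dB) => [||_ [x _ <-]].
- split; first by move=> a x y; rewrite lJ' lP'.
  exists (L * K); first exact: mulr_gt0.
  by move=> x; apply: le_trans (PL _) _; rewrite -mulrA; apply: ler_wpM2l; rewrite // ltW.
- split; first by move=> a x y; case: ifP => // _; rewrite scaler0 addr0.
  by exists 1 => // x; case: ifP => _; rewrite mul1r // normr0.
- by rewrite (J'P n).2 (P'P m).2 PJ; case: ifP => // _; rewrite linear0.
Qed.

End Operators.

(** * Dual spaces *)

Section DualOperators.
Context {R : realType} {V : normedModType R}.
Implicit Types f : dual V.

Definition dual_fun f : {linear V -> R^o} :=
  HB.pack (val f) (GRing.isLinear.Build _ _ _ _ _ (dual_linear f)).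

Lemma dual_apply_le f x : `|val f x| <= `|f| * `|x|.
Proof.
have [->|x0] := eqVneq x 0.
  by rewrite -[val f]/(dual_fun f : V -> R^o) linear0 !normr0 mulr0.
have nx : 0 < `|x| by rewrite normr_gt0.
have : `|val f (`|x|^-1 *: x)| <= `|f|.
  by apply: dual_norm_ub; rewrite normrZ normfV normr_id mulVf // gt_eqF.
rewrite -[val f]/(dual_fun f : V -> R^o) linearZ /= normrZ normfV normr_id.
by rewrite ler_pdivrMl // mulrC.
Qed.

Lemma dual_norm_le f (C : R) : 0 <= C ->
  (forall x, `|val f x| <= C * `|x|) -> `|f| <= C.
Proof.
move=> C0 fC; apply: ge_sup => [|_ [u u1 <-]]; first by case: (dual_has_sup f).
by apply: le_trans (fC u) _; rewrite ler_piMr.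
Qed.

Lemma bounded_dual_pred (l : V -> R^o) (C : R) :
  linear l -> (forall x, `|l x| <= C * `|x|) -> dual_pred l.
Proof.
move=> ll lC; apply/asboolP; split => //.
pose L : {linear V -> R^o} := HB.pack l (GRing.isLinear.Build _ _ _ _ _ ll).
suff : continuous L by [].
apply/linear_bounded_continuous/linear_boundedP.
near=> M => x; apply: le_trans (lC x) _.
apply: ler_wpM2r => //; near: M; exact: nbhs_pinfty_ge.
Unshelve. all: by end_near. Qed.

Lemma val_dual_sum (u : nat -> dual V) n x :
  val (\sum_(i < n) u i) x = \sum_(i < n) val (u i) x.
Proof.
elim: n => [|n IH]; first by rewrite !big_ord0.
by rewrite !big_ord_recr /= -IH.
Qed.

(** The sum is taken pointwise; the pointwise remainders are uniform on the ball. *)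
Lemma dual_geometrically_complete : geometrically_complete (dual V).
Proof.
move=> u C uC.
have C0 : 0 <= C.
  have := le_trans (normr_ge0 _) (uC 0%N); rewrite expr1.
  by rewrite pmulr_lge0 // invr_gt0.
have /choice[l lP] : forall x, exists s : R^o,
    forall n, `|s - \sum_(i < n) (val (u i) x : R^o)| <= (C * `|x|) * 2^-1 ^+ n.
  move=> x; apply: (@complete_geometrically_complete R R^o (fun i => val (u i) x)) => n.
  apply: le_trans (dual_apply_le _ _) _; rewrite mulrAC.
  by apply: ler_wpM2r => //; exact: uC.
have l_le x : `|l x| <= C * `|x|.
  by have := lP x 0%N; rewrite big_ord0 subr0 expr0 mulr1.
have ll : linear l.
  move=> a x y; apply/eqP; rewrite -subr_eq0 -normr_le0.
  apply: (le_geom (C := C * `|a *: x + y| + (`|a| * (C * `|x|) + C * `|y|))) => n.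
  rewrite add0r.
  have -> : l (a *: x + y) - (a *: l x + l y) =
      (l (a *: x + y) - \sum_(i < n) (val (u i) (a *: x + y) : R^o)) -
      (a *: (l x - \sum_(i < n) (val (u i) x : R^o)) + (l y - \sum_(i < n) (val (u i) y : R^o))).
    have -> : \sum_(i < n) (val (u i) (a *: x + y) : R^o) =
        a *: (\sum_(i < n) (val (u i) x : R^o)) + \sum_(i < n) (val (u i) y : R^o).
      by rewrite scaler_sumr -big_split; apply: eq_bigr => i _; rewrite (dual_linear (u i)).
    by rewrite !scalerBr; ring.
  apply: le_trans (ler_normB _ _) _; rewrite mulrDl; apply: lerD; first exact: lP.
  apply: le_trans (ler_normD _ _) _; rewrite mulrDl; apply: lerD; last exact: lP.
  by rewrite normrZ -mulrA; apply: ler_wpM2l => //; exact: lP.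
exists (Sub l (bounded_dual_pred ll l_le) : dual V) => n.
apply: dual_norm_le => [|x]; first by rewrite mulr_ge0 // exprn_ge0 // invr_ge0.
have -> : val ((Sub l (bounded_dual_pred ll l_le) : dual V) - \sum_(i < n) u i) x =
  l x - val (\sum_(i < n) u i) x by [].
by rewrite val_dual_sum mulrAC; exact: lP.
Qed.

Lemma transpose_pred (u : V -> V) f : bounded_operator u ->
  dual_pred (fun x => val f (u x)).
Proof.
move=> [lu [K K0 uK]]; apply: (@bounded_dual_pred _ (`|f| * K)).
  by move=> a x y; rewrite lu (dual_linear f).
by move=> x; apply: le_trans (dual_apply_le _ _) _; rewrite -mulrA ler_wpM2l.
Qed.

Definition transpose (u : V -> V) (bu : bounded_operator u) f : dual V :=
  Sub _ (transpose_pred f bu).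

Lemma transpose_bounded (u : V -> V) (bu : bounded_operator u) :
  bounded_operator (transpose bu).
Proof.
split; first by move=> a f g; apply: val_inj; apply/funext.
have [_ [K K0 uK]] := bu; exists K => // f.
apply: dual_norm_le => [|x]; first by rewrite mulr_ge0 // ltW.
apply: le_trans (dual_apply_le f (u x)) _.
by rewrite [K * _]mulrC -mulrA ler_wpM2l.
Qed.

(** Transposition reverses products, so the transposes of [P m] are the new embeddings. *)
Lemma dual_copies : contains_copies V -> contains_copies (dual V).
Proof.
move=> [J [P [bJ bP PJ]]].
exists (fun m => transpose (bP m)), (fun m => transpose (bJ m)); split=> [m|m|m n f].
- exact: transpose_bounded.
- exact: transpose_bounded.
- apply: val_inj; apply/funext => x /=; rewrite PJ eq_sym; case: ifP => // _.
  by rewrite -[val f]/(dual_fun f : V -> R^o) linear0.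
Qed.

End DualOperators.

(** * Continuous approximation of coarse maps *)

Section Approximation.
Context {R : realType}.

Lemma geom_limit_le (Y : normedModType R) (u : nat -> Y) s (C D : R) :
  (forall n, `|s - \sum_(i < n) u i| <= C * 2^-1 ^+ n) ->
  (forall n, `|u n| <= D * 2^-1 ^+ n.+1) -> `|s| <= D.
Proof.
move=> sC uD; apply: (le_geom (C := C)) => n.
have D0 : 0 <= D.
  have := le_trans (normr_ge0 _) (uD 0%N); rewrite expr1.
  by rewrite pmulr_lge0 // invr_gt0.
have := geom_sum_le 0 n uD; rewrite big_ord0 subr0 add0n expr0 => le.
have p0 : 0 <= D * (2^-1 : R) ^+ n by rewrite mulr_ge0 // exprn_ge0 // invr_ge0.
rewrite -(subrK (\sum_(i < n) u i) s); apply: le_trans (ler_normD _ _) _.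
have := sC n; lra.
Qed.

Lemma geom_limitB_le (Y : normedModType R) (u u' : nat -> Y) s s' (C C' D : R) :
  (forall n, `|s - \sum_(i < n) u i| <= C * 2^-1 ^+ n) ->
  (forall n, `|s' - \sum_(i < n) u' i| <= C' * 2^-1 ^+ n) ->
  (forall n, `|u n - u' n| <= D * 2^-1 ^+ n.+1) -> `|s - s'| <= D.
Proof.
move=> sC sC'; apply: (geom_limit_le (C := C + C')) => n.
have -> : s - s' - \sum_(i < n) (u i - u' i) =
    (s - \sum_(i < n) u i) - (s' - \sum_(i < n) u' i).
  by rewrite sumrB !opprB addrACA [RHS]addrACA [- s' - _]addrC.
by apply: le_trans (ler_normB _ _) _; rewrite mulrDl lerD.
Qed.

Lemma strict_well_order (T : eqType) : exists lt : T -> T -> Prop,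
  (forall A : set T, A !=set0 -> exists2 z, A z & forall y, A y -> ~ lt y z) /\
  (forall z z', z != z' -> lt z z' \/ lt z' z).
Proof.
have [W woW] := wochoice.well_ordering_principle T.
have minW (A : set T) : A !=set0 -> exists2 z, A z & forall y, A y -> W z y.
  move=> [a Aa]; have [|z [[zA zmin] _]] := woW (fun x => `[< A x >]).
    by exists a; exact/asboolP.
  by exists z => [|y Ay]; [exact/asboolP|apply: zmin; exact/asboolP].
have Wxx x : W x x by have [|z -> h] := minW [set x]; [exists x|exact: h].
exists (fun y z => ~~ W z y); split.
  by move=> A /minW[z Az zmin]; exists z => // y /zmin ->.
move=> z z' zz'; case W1: (W z z'); last by right.
case W2: (W z' z); last by left.
have [|m [_ mP]] := woW (pred2 z z'); first by exists z; rewrite inE eqxx.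
suff : z = z' by move/eqP; rewrite (negbTE zz').
by rewrite -(mP z) ?(mP z') //; split; rewrite ?inE ?eqxx ?orbT // => y;
  rewrite inE => /orP[]/eqP ->.
Qed.

(** Stone's partition of unity on a normed space for the cover by unit balls.  For a
well order of the points, a ball is active at [x] on level [n] if [x] lies deep
inside it and, for all earlier balls, at most slightly inside.  With the two thresholds
equal to [2^-1 ^+ n], at most one ball is active on each level, so that a countable
sum suffices even when [X] is not separable. *)
Section Partition.
Context {X : normedModType R} (lt : X -> X -> Prop).
Context (lt_wf :
  forall A : set X, A !=set0 -> exists2 z, A z & forall y, A y -> ~ lt y z).
Context (lt_total : forall z z', z != z' -> lt z z' \/ lt z' z).

Let bump (z x : X) : R := Num.max 0 (1 - `|x - z|).

Let bump_lip z x x' : bump z x <= bump z x' + `|x - x'|.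
Proof.
rewrite /bump; have := ler_distD x x' z; rewrite (distrC x' x).
have := normr_ge0 (x - x').
case: (leP 0 (1 - `|x - z|)); case: (leP 0 (1 - `|x' - z|)); lra.
Qed.

Let earlier z x : R := sup [set v | v = 0 \/ exists2 y, lt y z & v = bump y x].

Let earlier_ub z x : has_ubound [set v | v = 0 \/ exists2 y, lt y z & v = bump y x].
Proof.
exists 1 => _ [->//|[y _ ->]]; rewrite /bump ge_max ler01 /= lerBlDr.
by rewrite lerDl.
Qed.

Let le_earlier y z x : lt y z -> bump y x <= earlier z x.
Proof. by move=> yz; apply: (ub_le_sup (earlier_ub z x)); right; exists y. Qed.

Let earlier_ge0 z x : 0 <= earlier z x.
Proof. by apply: (ub_le_sup (earlier_ub z x)); left. Qed.

Let earlier_le z x c : 0 <= c -> (forall y, lt y z -> bump y x <= c) -> earlier z x <= c.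
Proof.
move=> c0 h; apply: ge_sup; first by exists 0; left.
by move=> _ [->//|[y yz ->]]; exact: h.
Qed.

Let earlier_lip z x x' : earlier z x <= earlier z x' + `|x - x'|.
Proof.
apply: earlier_le => [|y yz]; first by rewrite addr_ge0 // earlier_ge0.
by apply: le_trans (bump_lip y x x') _; rewrite lerD2r le_earlier.
Qed.

Definition stone (n : nat) (z x : X) : R :=
  Num.max 0 (Num.min (bump z x - 2^-1 ^+ n) (2^-1 ^+ n - earlier z x)).

Lemma stone_ge0 n z x : 0 <= stone n z x.
Proof. by rewrite le_max lexx. Qed.

Let stone_gt0 n z x :
  (0 < stone n z x) = (2^-1 ^+ n < bump z x) && (earlier z x < 2^-1 ^+ n).
Proof. by rewrite lt_max ltxx lt_min !subr_gt0. Qed.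

Lemma stone_le1 n z x : stone n z x <= 1.
Proof.
rewrite ge_max ler01 ge_min /=; apply/orP; left; rewrite lerBlDr.
have p0 : 0 <= (2^-1 : R) ^+ n by rewrite exprn_ge0 // invr_ge0.
rewrite /bump; have := normr_ge0 (x - z); case: (leP 0 (1 - `|x - z|)); lra.
Qed.

Lemma stone_lip n z x x' : stone n z x <= stone n z x' + `|x - x'|.
Proof.
have := bump_lip z x x'; have := earlier_lip z x' x; rewrite (distrC x' x) => h1 h2.
have d0 := normr_ge0 (x - x').
have le_min : Num.min (bump z x' - 2^-1 ^+ n) (2^-1 ^+ n - earlier z x') <= stone n z x'.
  by rewrite le_max lexx orbT.
rewrite {1}/stone ge_max addr_ge0 ?stone_ge0 //=.
apply: le_trans (lerD le_min (lexx _)); rewrite ge_min.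
by case: (leP (bump z x' - _)) => _; apply/orP; [left|right]; lra.
Qed.

Lemma stone_near n z x : 0 < stone n z x -> `|x - z| < 1.
Proof.
rewrite stone_gt0 => /andP[h _].
have p0 : 0 < (2^-1 : R) ^+ n by rewrite exprn_gt0 // invr_gt0.
by have := lt_trans p0 h; rewrite /bump lt_max ltxx subr_gt0.
Qed.

Lemma stone_uniq n z z' x : 0 < stone n z x -> 0 < stone n z' x -> z = z'.
Proof.
rewrite !stone_gt0 => /andP[b1 e1] /andP[b2 e2].
apply/eqP/negP => /negP /lt_total[]/(le_earlier x).
  by rewrite leNgt (lt_trans e2 b1).
by rewrite leNgt (lt_trans e1 b2).
Qed.

(** The first ball that contains [x] is active at [x] on every level fine enough. *)
Lemma stone_cover x : exists n z, 0 < stone n z x.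
Proof.
have [|z bz zmin] := lt_wf (A := [set z | 0 < bump z x]).
  by exists x; rewrite /= /bump subrr normr0 subr0 lt_max ltr01 orbT.
have [n] := geom_lt 1 bz; rewrite mul1r => bn.
have p0 : 0 < (2^-1 : R) ^+ n by rewrite exprn_gt0 // invr_gt0.
exists n, z; rewrite stone_gt0 bn /=; apply: le_lt_trans p0.
apply: earlier_le => // y yz; rewrite leNgt; apply/negP => by0.
by apply: zmin yz.
Qed.

Definition center n x : X := xget 0 [set z | 0 < stone n z x].

Lemma center_eq n z x : 0 < stone n z x -> center n x = z.
Proof. by move=> h; apply: xget_unique => // y /stone_uniq; apply. Qed.

(** If the active ball changes between [x] and [x'], the weight of each of the two
vanishes at the other point, hence is at most [`|x - x'|] at its own. *)
Lemma stone_sum_lip n (Y : normedModType R) (c : X -> Y) (C : R) x x' :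
  (forall z, 0 < stone n z x \/ 0 < stone n z x' -> `|c z| <= C) -> 0 <= C ->
  `|stone n (center n x) x *: c (center n x) -
    stone n (center n x') x' *: c (center n x')| <= 2 * C * `|x - x'|.
Proof.
move=> cC C0; have d0 := normr_ge0 (x - x').
have [<-|ne] := eqVneq (center n x) (center n x').
  set z := center n x; rewrite -scalerBl normrZ.
  have [z0|z0] := ltP 0 (stone n z x + stone n z x').
    have cz : `|c z| <= C.
      apply: cC; have [|zx] := ltP 0 (stone n z x); [by left|right].
      by apply: lt_le_trans z0 _; rewrite gerDr.
    have lip : `|stone n z x - stone n z x'| <= `|x - x'|.
      rewrite ler_distl; have := stone_lip n z x x'; have := stone_lip n z x' x.
      rewrite (distrC x' x); lra.
    apply: (@le_trans _ _ (`|x - x'| * C)); first exact: ler_pM.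
    nra.
  have [s1 s2] := (stone_ge0 n z x, stone_ge0 n z x').
  have -> : stone n z x = 0 by lra.
  have -> : stone n z x' = 0 by lra.
  by rewrite subrr normr0 mul0r !mulr_ge0.
have half y y' : (forall z, 0 < stone n z y -> `|c z| <= C) ->
    center n y != center n y' ->
    `|stone n (center n y) y *: c (center n y)| <= C * `|y - y'|.
  move=> cy nyy'; rewrite normrZ ger0_norm ?stone_ge0 //.
  have [y0|y0] := ltP 0 (stone n (center n y) y); last first.
    have -> : stone n (center n y) y = 0 by apply/eqP; rewrite eq_le y0 stone_ge0.
    by rewrite mul0r mulr_ge0.
  rewrite mulrC; apply: ler_pM => //; [exact: stone_ge0|exact: cy|].
  apply: le_trans (stone_lip _ _ _ y') _; rewrite gerDr leNgt.
  by apply/negP => /center_eq/eqP; rewrite eq_sym (negbTE nyy').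
have h1 := half x x' (fun z h => cC z (or_introl h)) ne.
have h2 := half x' x (fun z h => cC z (or_intror h)).
rewrite eq_sym (distrC x' x) in h2; have {}h2 := h2 ne.
by apply: le_trans (ler_normB _ _) _; lra.
Qed.

End Partition.

Lemma locally_lipschitz_continuous (X Y : normedModType R) (v : X -> Y) :
  (forall x0, exists K : R, forall x, `|x - x0| <= 1 -> `|v x - v x0| <= K * `|x - x0|) ->
  continuous v.
Proof.
move=> vlip x0; have [K vK] := vlip x0.
apply/cvgrPdist_lt => e e0.
have K1 : 0 < `|K| + 1 by rewrite ltr_wpDl.
near=> x.
have d1 : `|x0 - x| < 1 by near: x; apply: cvgr_dist_lt.
have d2 : `|x0 - x| < e / (`|K| + 1).
  by near: x; apply: cvgr_dist_lt; rewrite // divr_gt0.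
rewrite distrC; apply: le_lt_trans (vK x _) _; first by rewrite distrC ltW.
rewrite (distrC x); move: d2; rewrite ltr_pdivlMr //; apply: le_lt_trans.
by rewrite mulrC ler_wpM2l //; have := ler_norm K; lra.
Unshelve. all: by end_near. Qed.

(** The approximation is the weighted average of the values of [f] at the centers
active at [x], which are all within distance 1 of [x]. *)
Lemma continuous_approximation (X Y : normedModType R) (f : X -> Y) (L : R) :
  geometrically_complete Y -> 0 <= L ->
  (forall x y, `|x - y| <= 1 -> `|f x - f y| <= L) ->
  exists2 g : X -> Y, continuous g & forall x, `|g x - f x| <= L.
Proof.
move=> cY L0 fL.
have [lt [lt_wf lt_total]] := strict_well_order X.
pose z n x := center lt n x.
pose lam n x := stone lt n (z n x) x.
have lam0 n x : 0 <= lam n x by exact: stone_ge0.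
have lam1 n x : lam n x <= 1 by exact: stone_le1.
have p0 n : 0 < (2^-1 : R) ^+ n by rewrite exprn_gt0 // invr_gt0.
have f_near n y x : 0 < stone lt n y x -> `|f y - f x| <= L.
  by move=> /stone_near /ltW h; apply: fL; rewrite distrC.
have f_le n y x : 0 < stone lt n y x -> `|f y| <= `|f x| + L.
  move=> /f_near h; rewrite -(subrK (f x) (f y)) addrC.
  by apply: le_trans (ler_normD _ _) _; rewrite lerD2l.
pose u n x : Y := 2^-1 ^+ n.+1 *: (lam n x *: f (z n x)).
pose u' n x : R := 2^-1 ^+ n.+1 * lam n x.
have u_le n x : `|u n x| <= (`|f x| + L) * 2^-1 ^+ n.+1.
  rewrite !normrZ (ger0_norm (ltW (p0 _))) mulrC; apply: ler_wpM2r; first exact: ltW.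
  rewrite ger0_norm //.
  have [l0|l0] := ltP 0 (lam n x); last first.
    have -> : lam n x = 0 by apply/eqP; rewrite eq_le l0 lam0.
    by rewrite mul0r addr_ge0.
  by rewrite -[leRHS]mul1r; apply: ler_pM => //; exact: f_le l0.
have u'_le n x : `|u' n x| <= 1 * 2^-1 ^+ n.+1.
  rewrite normrM (ger0_norm (ltW (p0 _))) mulrC; apply: ler_wpM2r; first exact: ltW.
  by rewrite ger0_norm.
have /choice[v vP] : forall x, exists s, forall n,
    `|s - \sum_(i < n) u i x| <= (`|f x| + L) * 2^-1 ^+ n.
  by move=> x; apply: (cY (fun n => u n x)) => n; exact: u_le.
have /choice[w wP] : forall x, exists s : R^o, forall n,
    `|s - \sum_(i < n) (u' i x : R^o)| <= 1 * 2^-1 ^+ n.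
  move=> x; apply: (@complete_geometrically_complete R R^o (fun i => u' i x) 1) => n.
  exact: u'_le.
have cv : continuous v.
  apply: locally_lipschitz_continuous => x0; exists (2 * (`|f x0| + 2 * L)) => x xx0.
  apply: (geom_limitB_le (u := u^~ x) (u' := u^~ x0) (vP x) (vP x0)) => n.
  rewrite /u -scalerBr normrZ (ger0_norm (ltW (p0 _))) mulrC; apply: ler_wpM2r; first exact: ltW.
  apply: stone_sum_lip => //; last by have := normr_ge0 (f x0); lra.
  have fx : `|f x| <= `|f x0| + L.
    rewrite -(subrK (f x0) (f x)) addrC.
    by apply: le_trans (ler_normD _ _) _; rewrite lerD2l fL.
  by move=> y [|] /f_le; lra.
have cw : continuous (w : X -> R^o).
  apply: locally_lipschitz_continuous => x0; exists (2 * 1) => x _.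
  apply: (geom_limitB_le (Y := R^o) (u := u'^~ x) (u' := u'^~ x0) (wP x) (wP x0)) => n.
  rewrite /u' -mulrBr normrM (ger0_norm (ltW (p0 _))) mulrC; apply: ler_wpM2r; first exact: ltW.
  have := @stone_sum_lip _ _ lt_total n R^o (fun=> 1) 1 x x0.
  rewrite ![_ *: (1 : R^o)]mulr1; apply => // y _.
  by rewrite normr1.
have w_ge x n : u' n x <= w x.
  apply: (le_geom (C := 1)) => m.
  have := wP x (n.+1 + m)%N; rewrite big_split_ord /= big_ord_recr /=.
  have s1 : 0 <= \sum_(i < n) u' i x.
    by apply: sumr_ge0 => i _; rewrite mulr_ge0 // ltW.
  have s2 : 0 <= \sum_(i < m) u' (n.+1 + i)%N x.
    by apply: sumr_ge0 => i _; rewrite mulr_ge0 // ltW.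
  rewrite ler_distl => /andP[h _].
  have pm : (2^-1 : R) ^+ (n.+1 + m) <= 2^-1 ^+ m.
    by apply: ler_wiXn2l; rewrite ?invr_ge0 ?invf_le1 ?ler1n // leq_addl.
  lra.
have w0 x : 0 < w x.
  have [n [y yx]] := stone_cover lt_wf x.
  apply: lt_le_trans (w_ge x n); rewrite /u' mulr_gt0 // /lam /z.
  by rewrite (center_eq lt_total yx).
exists (fun x => (w x)^-1 *: v x).
  move=> x; apply: cvgZ; last exact: cv.
  by apply: cvgV; [rewrite gt_eqF|exact: cw].
move=> x.
have -> : (w x)^-1 *: v x - f x = (w x)^-1 *: (v x - w x *: f x).
  by rewrite scalerBr scalerA mulVf ?gt_eqF // scale1r.
rewrite normrZ ger0_norm ?invr_ge0 ?(ltW (w0 x)) // ler_pdivrMl // mulrC.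
have fin n : `|\sum_(i < n) u i x - (\sum_(i < n) u' i x) *: f x| <= L * \sum_(i < n) u' i x.
  elim: n => [|n IH]; first by rewrite !big_ord0 scale0r subrr normr0 mulr0.
  rewrite !big_ord_recr /= scalerDl opprD addrACA mulrDr.
  apply: le_trans (ler_normD _ _) _; apply: lerD => //.
  rewrite /u /u' scalerA -scalerBr normrZ ger0_norm ?mulr_ge0 ?(ltW (p0 _)) // mulrC.
  have [l0|l0] := ltP 0 (lam n x).
    apply: ler_wpM2r; first by rewrite mulr_ge0 // ltW.
    exact: f_near l0.
  have -> : lam n x = 0 by apply/eqP; rewrite eq_le l0 lam0.
  by rewrite !mulr0.
apply: (le_geom (C := `|f x| + L + L + `|f x|)) => n.
have h1 := vP x n; have h2 := wP x n; have h3 := fin n.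
have -> : v x - w x *: f x = (v x - \sum_(i < n) u i x) +
    (\sum_(i < n) u i x - (\sum_(i < n) u' i x) *: f x) -
    (w x - \sum_(i < n) u' i x) *: f x.
  by rewrite scalerBl addrA subrK opprB addrA subrK.
apply: le_trans (ler_normB _ _) _; rewrite normrZ.
apply: le_trans (lerD (ler_normD _ _) (lexx _)) _.
have h4 := ler_wpM2r (normr_ge0 (f x)) h2.
move: h2; rewrite ler_distl => /andP[h5 h6]; have := ler_wpM2l L0 h5.
lra.
Qed.

End Approximation.

(** * From coarse embeddings to homeomorphic ones *)

Section Coarse.
Context {R : realType}.

Lemma coarse_step (X Y : normedModType R) (f : X -> Y) : coarse f ->
  exists2 L : R, 0 <= L & forall x y, `|x - y| <= 1 -> `|f x - f y| <= L.
Proof.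
move=> /(_ 1 ler01) f1.
have le x y : `|x - y| <= 1 -> (`|f x - f y|%:E <= omega f 1)%E.
  by move=> xy; apply: ereal_sup_ubound; exists (x, y).
have f0 : (0 <= omega f 1)%E.
  by have := le 0 0; rewrite !subrr !normr0; apply; exact: ler01.
have ffin : omega f 1 \is a fin_num by rewrite ge0_fin_numE.
exists (fine (omega f 1)); first exact: fine_ge0.
by move=> x y /le; rewrite -[X in (_ <= X)%E]fineK // lee_fin.
Qed.

(** A segment of length at most [n] is cut into [n] steps of length at most 1. *)
Lemma step_affine (X Y : normedModType R) (f : X -> Y) (L : R) : 0 <= L ->
  (forall x y, `|x - y| <= 1 -> `|f x - f y| <= L) ->
  forall x y, `|f x - f y| <= L * (`|x - y| + 1).
Proof.
move=> L0 fL.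
have steps n : forall x y, `|x - y| <= n%:R -> `|f x - f y| <= L * n%:R.
  elim: n => [|n IH] x y.
    by rewrite normr_le0 subr_eq0 => /eqP ->; rewrite subrr normr0 mulr0.
  move=> xy; have n0 : 0 < (n.+1%:R : R) by rewrite ltr0n.
  pose p := y + n.+1%:R^-1 *: (x - y).
  have px : `|x - p| <= n%:R.
    have -> : x - p = (1 - n.+1%:R^-1) *: (x - y).
      by rewrite scalerBl scale1r /p opprD addrA.
    have h : 0 <= 1 - (n.+1%:R : R)^-1 by rewrite subr_ge0 invf_le1 // ler1n.
    rewrite normrZ ger0_norm //; apply: le_trans (ler_wpM2l h xy) _.
    by rewrite mulrBl mul1r mulVf ?gt_eqF // -natr1 addrK.
  have py : `|p - y| <= 1.
    rewrite /p addrC addKr normrZ ger0_norm ?invr_ge0 ?ler0n //.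
    by rewrite ler_pdivrMl // mulr1.
  rewrite -(subrK (f p) (f x)) -addrA; apply: le_trans (ler_normD _ _) _.
  by rewrite -natr1 mulrDr mulr1; apply: lerD; [exact: IH|exact: fL].
move=> x y; have d0 := normr_ge0 (x - y).
have /andP[h1 h2] := truncn_itv d0.
apply: le_trans (steps (Num.truncn `|x - y|).+1 _ _ (ltW h2)) _.
by apply: ler_wpM2l => //; rewrite -natr1 lerD2r.
Qed.

Lemma affine_coarse (X Y : normedModType R) (f : X -> Y) (C : R) : 0 <= C ->
  (forall x y, `|f x - f y| <= C * (`|x - y| + 1)) -> coarse f.
Proof.
move=> C0 fC t t0; apply: (@le_lt_trans _ _ (C * (t + 1))%:E); last exact: ltry.
apply: ge_ereal_sup => _ [[x y] /= xy <-]; rewrite lee_fin.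
by apply: le_trans (fC x y) _; apply: ler_wpM2l => //; rewrite lerD2r.
Qed.

Lemma expandingP (X Y : normedModType R) (f : X -> Y) : expanding f <->
  forall M : R, exists t, forall x y, t <= `|x - y| -> M <= `|f x - f y|.
Proof.
split=> [/cvgeyPge h M|h].
  have [t [_ ht]] := h M; exists (t + 1) => x y xy.
  have := ht (t + 1); rewrite ltrDl ltr01 => /(_ isT) /= le.
  rewrite -lee_fin; apply: le_trans le _.
  by apply: ereal_inf_lbound; exists (x, y).
apply/cvgeyPge => M; have [t ht] := h M.
exists t; split; first exact: num_real.
move=> s ts /=; apply: le_ereal_inf_tmp => _ [[x y] /= xy <-].
by rewrite lee_fin; apply: ht; apply: le_trans xy; exact: ltW.
Qed.

Lemma inverse_unif_continuous (X Y : normedModType R) (f : X -> Y) (g : Y -> X) :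
  cancel f g ->
  (forall e : R, 0 < e -> exists2 d : R, 0 < d &
     forall x y, `|f x - f y| < d -> `|x - y| < e) ->
  unif_continuous (g : subspace (range f) -> X).
Proof.
move=> fK mod U; rewrite -entourage_ballE => -[e /= e0 eU].
have [d d0 de] := mod e e0.
exists [set xy | ball xy.1 d xy.2] => /=.
  by rewrite -entourage_ballE; exists d.
move=> [a b] /= [->|[[x _ <-] [[y _ <-] xy]]]; apply: eU => /=.
  exact: ballxx.
by rewrite !fK -ball_normE /=; apply: de; move: xy; rewrite -ball_normE.
Qed.

Lemma unif_continuous_continuous (U V : uniformType) (f : U -> V) :
  unif_continuous f -> continuous f.
Proof.
move=> uf x; apply/cvg_app_entourageP => A /uf /(nbhs_entourage x).
by apply: filterS => y /xsectionP.
Qed.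

Lemma bounded_operator0 (V W : normedModType R) (T : V -> W) :
  bounded_operator T -> T 0 = 0.
Proof. by move=> bT; have := bounded_operatorB 0 0 bT; rewrite !subrr. Qed.

Lemma operator_sum (Y : normedModType R) (T : Y -> Y) (a : nat -> Y) n :
  bounded_operator T -> T (\sum_(i < n) a i) = \sum_(i < n) T (a i).
Proof.
move=> bT.
elim: n => [|n IH]; first by rewrite !big_ord0 (bounded_operator0 bT).
have := bT.1 1 (\sum_(i < n) a i) (a n).
by rewrite !scale1r IH => TS; rewrite !big_ord_recr.
Qed.

Lemma operator_continuous (V W : normedModType R) (T : V -> W) :
  bounded_operator T -> continuous T.
Proof.
move=> bT; have [_ [K K0 TK]] := bT.
apply: locally_lipschitz_continuous => x0; exists K => x _.
by rewrite -(bounded_operatorB _ _ bT).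
Qed.

(** The map is [F x = \sum_m eps m *: J m (g (m.+1%:R *: x) - g 0)] for a continuous
approximation [g] of the given coarse embedding; [F_coord] is the recovery of the
component [m] by [P m]. *)
Theorem coarse_to_homeomorphic (X Y : normedModType R) :
  geometrically_complete Y -> contains_copies Y ->
  (exists f : X -> Y, coarse_embedding f) ->
  exists (f : X -> Y) (g : Y -> X),
    [/\ homeomorphism_onto_image f g, coarse_embedding f &
        unif_continuous (g : subspace (range f) -> X)].
Proof.
move=> cY [J [P [bJ bP PJ]]] [f [f_coarse /expandingP f_exp]].
have [L L0 fL] := coarse_step f_coarse.
have [g cg gf] := continuous_approximation cY L0 fL.
have p0 n : 0 < (2^-1 : R) ^+ n by rewrite exprn_gt0 // invr_gt0.
have g_affine x y : `|g x - g y| <= 3 * L * (`|x - y| + 1).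
  have -> : g x - g y = (g x - f x) + (f x - f y) - (g y - f y).
    by rewrite opprB !addrA !subrK.
  apply: le_trans (ler_normB _ _) _; apply: le_trans (lerD (ler_normD _ _) (lexx _)) _.
  have := gf x; have := gf y; have := step_affine L0 fL x y.
  have := normr_ge0 (x - y); nra.
have g_exp M : exists t, forall x y, t <= `|x - y| -> M <= `|g x - g y|.
  have [t ht] := f_exp (M + 2 * L); exists t => x y /ht h.
  have fg : f x - f y = (g x - g y) - (g x - f x) + (g y - f y).
    by rewrite opprB [g x - g y + _]addrC !addrA !subrK.
  have := ler_normD (g x - g y - (g x - f x)) (g y - f y); rewrite -fg.
  have := ler_normB (g x - g y) (g x - f x); have := gf x; have := gf y; lra.
have /choice[K KP] : forall m, exists K : R, 0 < K /\ forall y, `|J m y| <= K * `|y|.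
  by move=> m; have [_ [K K0 JK]] := bJ m; exists K.
have /choice[K' K'P] : forall m, exists K : R, 0 < K /\ forall y, `|P m y| <= K * `|y|.
  by move=> m; have [_ [K' K'0 PK]] := bP m; exists K'.
(* K m compensates the norm of J m, and m + 1 the dilation of the argument *)
pose eps m := 2^-1 ^+ m.+1 / (m.+1%:R * K m).
have eps0 m : 0 < eps m by rewrite divr_gt0 // mulr_gt0 ?ltr0n // (KP m).1.
pose u m x := eps m *: J m (g (m.+1%:R *: x) - g 0).
have u_lip m x y : `|u m x - u m y| <= 3 * L * (`|x - y| + 1) * 2^-1 ^+ m.+1.
  rewrite /u -scalerBr -(bounded_operatorB _ _ (bJ m)) opprB addrA subrK normrZ.
  rewrite (ger0_norm (ltW (eps0 m))); have [Km JK] := KP m.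
  have m0 : 0 < (m.+1%:R : R) by rewrite ltr0n.
  have m1 : 1 <= (m.+1%:R : R) by rewrite ler1n.
  have gm : `|g (m.+1%:R *: x) - g (m.+1%:R *: y)| <= m.+1%:R * (3 * L * (`|x - y| + 1)).
    apply: le_trans (g_affine _ _) _; rewrite -scalerBr normrZ gtr0_norm //.
    by rewrite mulrCA; apply: ler_wpM2l; [rewrite mulr_ge0|lra].
  apply: le_trans (ler_wpM2l (ltW (eps0 m)) (JK _)) _.
  apply: le_trans (ler_wpM2l (ltW (eps0 m)) (ler_wpM2l (ltW Km) gm)) _.
  have epsE : eps m * K m * m.+1%:R = 2^-1 ^+ m.+1.
    by rewrite -mulrA (mulrC (K m)) divfK // gt_eqF // mulr_gt0.
  by rewrite [leRHS]mulrC -epsE !mulrA.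
have u0 m : u m 0 = 0.
  by rewrite /u scaler0 subrr (bounded_operator0 (bJ m)) scaler0.
have u_le m x : `|u m x| <= 3 * L * (`|x| + 1) * 2^-1 ^+ m.+1.
  by have := u_lip m x 0; rewrite u0 !subr0.
have /choice[F FP] : forall x, exists s, forall n,
    `|s - \sum_(i < n) u i x| <= 3 * L * (`|x| + 1) * 2^-1 ^+ n.
  by move=> x; apply: (cY (u^~ x)) => m; exact: u_le.
have F_coord m x y :
    `|g (m.+1%:R *: x) - g (m.+1%:R *: y)| <= K' m / eps m * `|F x - F y|.
  have [K'm PK] := K'P m.
  have PF z : P m (F z) = eps m *: (g (m.+1%:R *: z) - g 0).
    apply/eqP; rewrite -subr_eq0 -normr_le0.
    apply: (le_geom (C := K' m * (3 * L * (`|z| + 1)))) => n; rewrite add0r.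
    have pn : (2^-1 : R) ^+ (m.+1 + n) <= 2^-1 ^+ n.
      by apply: ler_wiXn2l; rewrite ?invr_ge0 ?invf_le1 ?ler1n // leq_addl.
    have -> : eps m *: (g (m.+1%:R *: z) - g 0) = P m (\sum_(i < m.+1 + n) u i z).
      have Pu i : P m (u i z) = if m == i then eps i *: (g (i.+1%:R *: z) - g 0) else 0.
        have PZ c v : P m (c *: v) = c *: P m v.
          by have := (bP m).1 c v 0; rewrite (bounded_operator0 (bP m)) !addr0.
        by rewrite PZ PJ; case: ifP => // _; rewrite scaler0.
      rewrite (operator_sum (u^~ z) _ (bP m)).
      have mlt : (m < m.+1 + n)%N by rewrite ltn_addr.
      rewrite (bigD1 (Ordinal mlt)) //= Pu eqxx big1 ?addr0 // => i /eqP im.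
      by rewrite Pu; case: eqP => // mi; case: im; exact: val_inj.
    rewrite -(bounded_operatorB _ _ (bP m)); apply: le_trans (PK _) _.
    rewrite -mulrA; apply: ler_wpM2l; first exact: ltW.
    apply: le_trans (FP z _) _; apply: ler_wpM2l => //.
    by rewrite !mulr_ge0 // addr_ge0.
  have : `|P m (F x) - P m (F y)| <= K' m * `|F x - F y|.
    by rewrite -(bounded_operatorB _ _ (bP m)).
  rewrite !PF -scalerBr opprB addrA subrK normrZ (ger0_norm (ltW (eps0 m))).
  by move=> h; rewrite mulrAC ler_pdivlMr // mulrC.
have cS n : continuous (fun x => \sum_(i < n) u i x).
  elim: n => [|n IH] x.
    under eq_fun do rewrite big_ord0.
    exact: cvg_cst.
  under eq_fun do rewrite big_ord_recr.
  apply: continuousD; first exact: IH.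
  apply: continuousZ; first exact: cvg_cst.
  apply: (@continuous_comp _ _ _ (fun x => g (n.+1%:R *: x) - g 0) (J n)).
    apply: continuousB; last exact: cvg_cst.
    apply: (@continuous_comp _ _ _ (fun x => n.+1%:R *: x) g); last exact: cg.
    exact: scaler_continuous.
  exact: operator_continuous.
have cF : continuous F.
  move=> x0; apply/cvgrPdist_lt => e e0.
  have e3 : 0 < e / 3 by rewrite divr_gt0.
  have [n ne] := geom_lt (3 * L * (`|x0| + 2)) e3.
  near=> x.
  have d1 : `|x0 - x| < 1 by near: x; apply: cvgr_dist_lt.
  have d2 : `|\sum_(i < n) u i x0 - \sum_(i < n) u i x| < e / 3.
    by near: x; move/cvgrPdist_lt : (cS n x0); exact.
  have x_le : `|x| <= `|x0| + 1.
    rewrite -(subKr x0 x); apply: le_trans (ler_normB _ _) _.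
    by rewrite lerD2l ltW.
  have tail y : `|y| <= `|x0| + 1 -> `|F y - \sum_(i < n) u i y| <= e / 3.
    move=> yx; apply: le_trans (FP y n) _; apply: le_trans (ltW ne).
    apply: ler_wpM2r; first exact: ltW.
    by apply: ler_wpM2l; [rewrite mulr_ge0|lra].
  have -> : F x0 - F x = (F x0 - \sum_(i < n) u i x0) +
      (\sum_(i < n) u i x0 - \sum_(i < n) u i x) - (F x - \sum_(i < n) u i x).
    by rewrite opprB !addrA !subrK.
  apply: le_lt_trans (ler_normB _ _) _.
  apply: le_lt_trans (lerD (ler_normD _ _) (lexx _)) _.
  have := tail x x_le; have := tail x0; rewrite lerDl ler01 => /(_ isT); lra.
have F_coarse : coarse F.
  apply: (@affine_coarse _ _ _ (3 * L)); first by rewrite mulr_ge0.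
  move=> x y; apply: (geom_limitB_le (u := u^~ x) (u' := u^~ y) (FP x) (FP y)) => m.
  exact: u_lip.
have F_exp : expanding F.
  apply/expandingP => M; have [t ht] := g_exp (K' 0%N / eps 0%N * M).
  exists t => x y /ht h; have := F_coord 0%N x y; rewrite !scale1r => /(le_trans h).
  by rewrite ler_pM2l // divr_gt0 // (K'P 0%N).1.
have F_mod (e : R) : 0 < e -> exists2 d : R, 0 < d &
    forall x y, `|F x - F y| < d -> `|x - y| < e.
  move=> e0; have [t ht] := g_exp 1.
  pose m := Num.truncn (`|t| / e); exists (eps m / K' m).
    by rewrite divr_gt0 // (K'P m).1.
  move=> x y Fxy; rewrite ltNge; apply/negP => exy.
  have tm : t <= `|m.+1%:R *: x - m.+1%:R *: y|.
    rewrite -scalerBr normrZ normr_nat; apply: le_trans (ler_norm t) _.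
    have /andP[_ /ltW] := truncn_itv (divr_ge0 (normr_ge0 t) (ltW e0)).
    by rewrite ler_pdivrMr // => /le_trans; apply; rewrite ler_wpM2l.
  have := le_trans (ht _ _ tm) (F_coord m x y).
  have K'm := (K'P m).1.
  have := Fxy; rewrite -(ltr_pM2l (divr_gt0 K'm (eps0 m))) [X in _ < X]mulrA divfK ?gt_eqF //.
  by rewrite divff ?gt_eqF // => /lt_le_trans h /h; rewrite ltxx.
have F_inj : injective F.
  move=> x y Fxy; apply/eqP; rewrite -subr_eq0 -normr_le0; apply/ler_addgt0Pr => e e0.
  by have [d d0 hd] := F_mod e e0; rewrite add0r ltW // hd // Fxy subrr normr0.
have /choice[G FG'] : forall y, exists x, (exists x', F x' = y) -> F x = y.
  move=> y; have [[x Fx]|nx] := pselect (exists x', F x' = y); first by exists x.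
  by exists 0.
have FG : cancel F G by move=> x; apply: F_inj; apply: FG'; exists x.
have uG := inverse_unif_continuous FG F_mod.
exists F, G; split => //; split => //.
exact: unif_continuous_continuous.
Unshelve. all: by end_near. Qed.

End Coarse.

(** * Copies inside the Tsirelson and Schlumprecht spaces *)

(** In terms of coordinates, which are counted from 1, [i.+1] is sent to
[2 ^ m * (2 * i + 1)]: the exponent of 2 tells the ranges apart. *)
Definition dyadic (m i : nat) : nat := (2 ^ m * i.*2.+1).-1.

Lemma dyadic_succ m i : (dyadic m i).+1 = (2 ^ m * i.*2.+1)%N.
Proof. by rewrite prednK // muln_gt0 expn_gt0. Qed.

Lemma dyadic_incr m : {homo dyadic m : i j / (i < j)%N}.
Proof.
move=> i j ij; rewrite -ltnS !dyadic_succ ltn_pmul2l ?expn_gt0 //.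
by rewrite ltnS ltn_double.
Qed.

Lemma dyadic_linear m i : ((dyadic m i).+1 <= 2 ^ m.+1 * i.+1)%N.
Proof. by rewrite dyadic_succ expnSr -mulnA leq_mul2l; lia. Qed.

Lemma dyadic_disjoint m n i j : dyadic m i = dyadic n j -> m = n.
Proof.
have logE k l : logn 2 (dyadic k l).+1 = k.
  rewrite dyadic_succ lognM ?expn_gt0 // pfactorK // logn_coprime ?addn0 //.
  by rewrite coprime2n /= odd_double.
by move=> e; rewrite -(logE m i) e logE.
Qed.

Section Spaces.
Context {R : realType}.

Lemma pull_spread m n (x : c00 R) :
  pull (@dyadic_incr m) (spread (dyadic n) x) = if m == n then x else 0.
Proof.
apply: c00_eq => i; rewrite -[LHS]/(val (spread (dyadic n) x) (dyadic m i)).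
have [<-|mn] := eqVneq; first by rewrite (spreadE (@dyadic_incr m)).
by rewrite spread_out // => j; apply: contra_neq mn => /dyadic_disjoint.
Qed.

Lemma tsirelson_copies (T : completeNormedModType R) :
  is_tsirelson_space T -> contains_copies T.
Proof.
move=> [N NT TN].
apply: (completion_copies NT.1 TN (fun m => spread_linear (dyadic m))
  (fun m => pull_linear (@dyadic_incr m)) _ _ pull_spread) => m.
- exists (2 * 2 ^ m.+1)%:R; first by rewrite ltr0n muln_gt0 expn_gt0.
  move=> x; apply: tsirelson_spread => //; [exact: dyadic_incr|exact: dyadic_linear].
- by exists 1 => // x; rewrite mul1r tsirelson_pull.
Qed.

Lemma schlumprecht_copies (S : completeNormedModType R) :
  is_schlumprecht_space S -> contains_copies S.
Proof.
move=> [N NS SN].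
apply: (completion_copies NS.1 SN (fun m => spread_linear (dyadic m))
  (fun m => pull_linear (@dyadic_incr m)) _ _ pull_spread) => m.
- by exists 1 => // x; rewrite mul1r schlumprecht_spread //; exact: dyadic_incr.
- by exists 1 => // x; rewrite mul1r schlumprecht_pull.
Qed.

End Spaces.

Theorem corollary5p2 (R : realType) (X : completeNormedModType R) :
  (forall T : completeNormedModType R, is_tsirelson_space T ->
    (exists f : X -> dual T, coarse_embedding f) ->
    exists (f : X -> dual T) (g : dual T -> X),
      [/\ homeomorphism_onto_image f g, coarse_embedding f &
          unif_continuous (g : subspace (range f) -> X)]) /\
  (forall S : completeNormedModType R, is_schlumprecht_space S ->
    (exists f : X -> S, coarse_embedding f) ->
    exists (f : X -> S) (g : S -> X),
      [/\ homeomorphism_onto_image f g, coarse_embedding f &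
          unif_continuous (g : subspace (range f) -> X)]).
Proof.
split=> [T /tsirelson_copies /dual_copies copies | S /schlumprecht_copies copies].
  exact: (coarse_to_homeomorphic dual_geometrically_complete copies).
apply: (coarse_to_homeomorphic _ copies).
exact: complete_geometrically_complete.
Qed.
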